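(* Let $N\ge 1$, let $\Omega\subset\mathbb{R}^N$ be a bounded domain (with at least $C^2$-smooth boundary if $N\ge 2$), let $1<q<p$, and let $a\in C(\overline{\Omega})$ be sign-changing. Then the extended function $M:\mathbb{R}\to\mathbb{R}\cup\{-\infty\}$ has the following properties: (i) $M$ is nonincreasing on $\mathbb{R}$ and (strictly) decreasing on $(-\infty,\lambda^*]$. (ii) $M$ is continuous on $(-\infty,\lambda^* )$. (iii) $M(\lambda)\to M(\lambda^* )$ as $\lambda\to\lambda^*-0$ (i.e., from the left).
   Context: ''Sign-changing'' means that $\{x\in\Omega: a(x)>0\}$ and $\{x\in\Omega: a(x)<0\}$ are both nonempty. $W_0^{1,p}=W_0^{1,p}(\Omega)$, and $\|\cdot\|_r$ is the norm of $L^r(\Omega)$. For $\lambda\in\mathbb{R}$ and $u\in W_0^{1,p}$ put $E_\lambda(u):=\int_\Omega|\nabla u|^p\,dx-\lambda\int_\Omega|u|^p\,dx$ and $I_\lambda(u):=\frac1p E_\lambda(u)-\frac1q\int_\Omega a|u|^q\,dx$. The Nehari manifold is $\mathcal{N}_\lambda:=\{u\in W_0^{1,p}\setminus\{0\}: E_\lambda(u)=\int_\Omega a|u|^q\,dx\}$ (it is nonempty for every $\lambda$), and $M(\lambda):=\inf\{I_\lambda(u): u\in\mathcal{N}_\lambda\}$. Further, $$\lambda^*:=\inf\left\{\frac{\|\nabla u\|_p^p}{\|u\|_p^p}: u\in W_0^{1,p}\setminus\{0\},\ \int_\Omega a|u|^q\,dx\ge 0\right\}.$$ *)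

(* Defs.v *)
From HB Require Import structures.
From mathcomp Require Import all_boot all_order all_algebra.
From mathcomp Require Import all_classical all_reals all_analysis.
Import Order.TTheory GRing.Theory Num.Theory.
Import numFieldNormedType.Exports.

Set Implicit Arguments.
Unset Strict Implicit.
Unset Printing Implicit Defensive.

Local Open Scope classical_set_scope.
Local Open Scope ring_scope.

(* The sigma-algebra on R^n generated by the coordinates; by separability it is
   the Borel sigma-algebra (see [open_measurable_rV]). *)
Section measurable_rV.
Variables (R : realType) (n : nat).

Let coord (i : 'I_n) (v : 'rV[R]_n) : measurableTypeR R := v ord0 i.

Let rV_set0 : g_sigma_preimage coord set0.
Proof. exact: sigma_algebra0. Qed.

Let rV_setC A : g_sigma_preimage coord A -> g_sigma_preimage coord (~` A).
Proof. exact: sigma_algebraC. Qed.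

Let rV_bigcup (F : (set 'rV[R]_n)^nat) :
  (forall i, g_sigma_preimage coord (F i)) ->
  g_sigma_preimage coord (\bigcup_i (F i)).
Proof. exact: sigma_algebra_bigcup. Qed.

HB.instance Definition _ := @isMeasurable.Build default_measure_display
  'rV[R]_n (g_sigma_preimage coord) rV_set0 rV_setC rV_bigcup.

Lemma measurable_coord i : measurable_fun setT (coord i).
Proof.
move=> _ Y mY; rewrite setTI; apply: sub_sigma_algebra => /=.
rewrite -bigcup_seq/=; exists i => /=; first by rewrite mem_index_enum.
by exists Y => //; rewrite setTI.
Qed.

Lemma measurable_fun_rV d (T : measurableType d) (f : T -> 'rV[R]_n) :
  (forall i, measurable_fun setT (coord i \o f)) -> measurable_fun setT f.
Proof.
move=> mf.
suff H : g_sigma_preimage (fun i => coord i \o f) `<=` measurable.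
  rewrite g_sigma_preimage_comp in H.
  by move=> _ A mA; apply: H; exists A.
apply: smallest_sub; first exact: sigma_algebra_measurable.
move=> A; rewrite -bigcup_seq/= => -[i _ [B mB <-]].
exact: mf.
Qed.

Lemma measurable_box (A : 'I_n -> set R) : (forall i, measurable (A i)) ->
  measurable [set v : 'rV[R]_n | forall i, A i (v ord0 i)].
Proof.
move=> mA.
rewrite [X in measurable X](_ : _ = \bigcap_i (coord i @^-1` A i)).
  apply: fin_bigcap_measurable => [|i _]; first exact: finite_finset.
  rewrite -[X in measurable X]setTI; apply: measurable_coord => //.
  exact: mA.
by apply/seteqP; split=> [v Av i _|v Av i]; apply: Av.
Qed.

Lemma open_measurable_rV (A : set 'rV[R]_n) : open A -> measurable A.
Proof.
move=> oA.
pose box (c : 'rV[rat]_n * rat) : set 'rV[R]_n :=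
  [set v | forall i, ball (ratr (c.1 ord0 i) : R) (ratr c.2) (v ord0 i)].
have -> : A = \bigcup_c (if `[< box c `<=` A >] then box c else set0).
  apply/seteqP; split=> [v Av|v [c _]]; last first.
    by case: asboolP => // + cv; exact.
  have /nbhs_ballP[e /= e0 eA] : nbhs v A by move: oA; rewrite openE; exact.
  have e20 : 0 < e / 2 by rewrite divr_gt0.
  have [r /[!in_itv]/= /andP[r0 re]] := rat_in_itvoo e20.
  have rp i : exists s, ratr s \in `](v ord0 i - ratr r), (v ord0 i + ratr r)[.
    have : v ord0 i - ratr r < v ord0 i + ratr r.
      by rewrite ltrD2l (lt_trans _ r0)// oppr_lt0.
    by move=> /rat_in_itvoo[s ?]; exists s.
  pose w := \row_i (projT1 (cid (rp i))).
  have wv i : ball (ratr (w ord0 i) : R) (ratr r) (v ord0 i).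
    rewrite /w mxE; case: cid => s /=.
    by rewrite in_itv /= /ball /= -ltr_distlC => sv; rewrite distrC.
  exists (w, r) => //; case: asboolP => // -[] u wu.
  apply: eA; split=> // i j; rewrite (ord1 i) [e]splitr.
  apply: (@ball_triangle _ _ (ratr (w ord0 j) : R)).
    by apply: ball_sym; exact: (le_ball (ltW re)) (wv j).
  exact: (le_ball (ltW re)) (wu j).
apply: countable_bigcupT_measurable => // c; case: ifP => // _.
apply: (@measurable_box (fun i => ball (ratr (c.1 ord0 i) : R) (ratr c.2))).
by move=> i; exact: measurable_realfun.measurable_ball.
Qed.

End measurable_rV.

(* Lebesgue measure on R^n, by induction on n: the image of the product measure
   on R * R^n under the isomorphism [cons_rV] with R^n.+1. *)
Section lebesgue_rV.
Variable R : realType.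

Let T1 := measurableTypeR R.

Definition cons_rV n (x : T1 * 'rV[R]_n) : 'rV[R]_n.+1 :=
  \row_i (if unlift ord0 i is Some j then x.2 ord0 j else x.1).

Definition uncons_rV n (v : 'rV[R]_n.+1) : T1 * 'rV[R]_n :=
  (v ord0 ord0, \row_j v ord0 (lift ord0 j)).

Lemma cons_rVK n : cancel (@cons_rV n) (@uncons_rV n).
Proof.
move=> [x v]; rewrite /uncons_rV mxE unlift_none /=; congr pair.
by apply/rowP => j; rewrite !mxE liftK.
Qed.

Lemma measurable_cons_rV n : measurable_fun setT (@cons_rV n).
Proof.
apply: measurable_fun_rV => i.
case: (unliftP ord0 i) => [j|] ->.
  rewrite [X in measurable_fun _ X](_ : _ =
      (fun v : 'rV[R]_n => v ord0 j : T1) \o snd).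
    by apply: measurableT_comp => //; exact: measurable_coord.
  by apply/funext => x; rewrite /= mxE liftK.
rewrite [X in measurable_fun _ X](_ : _ = fst) //.
by apply/funext => x; rewrite /= mxE unlift_none.
Qed.

Lemma measurable_uncons_rV n : measurable_fun setT (@uncons_rV n).
Proof.
apply/measurable_fun_pairP; split; first exact: measurable_coord.
apply: measurable_fun_rV => i.
rewrite [X in measurable_fun _ X](_ : _ =
    fun v : 'rV[R]_n.+1 => v ord0 (lift ord0 i) : T1).
  exact: measurable_coord.
by apply/funext => x /=; rewrite mxE.
Qed.

Section step.
Local Open Scope ereal_scope.
Variables (n : nat) (m : {sigma_finite_measure set 'rV[R]_n -> \bar R}).

Let prod : {measure set (T1 * 'rV[R]_n)%type -> \bar R} :=
  (@lebesgue_measure R) \x m.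

Definition lebesgue_step : set 'rV[R]_n.+1 -> \bar R :=
  pushforward prod (@cons_rV n).

Let measurable_cons_preimage A :
  measurable A -> measurable (@cons_rV n @^-1` A).
Proof.
by move=> mA; rewrite -[X in measurable X]setTI; exact: measurable_cons_rV.
Qed.

Let step0 : lebesgue_step set0 = 0.
Proof. by rewrite /lebesgue_step /pushforward preimage_set0 measure0. Qed.

Let step_ge0 A : 0 <= lebesgue_step A.
Proof. exact: (measure_ge0 prod). Qed.

Let step_sigma_additive : semi_sigma_additive lebesgue_step.
Proof.
move=> F mF tF mUF; rewrite /lebesgue_step /pushforward preimage_bigcup.
apply: measure_semi_sigma_additive.
- by move=> k; exact: measurable_cons_preimage.
- apply/trivIsetP => /= i j _ _ ij; rewrite -preimage_setI.
  by move/trivIsetP : tF => /(_ _ _ _ _ ij) ->//; rewrite preimage_set0.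
- by rewrite -preimage_bigcup; exact: measurable_cons_preimage.
Qed.

HB.instance Definition _ := isMeasure.Build _ _ _
  lebesgue_step step0 step_ge0 step_sigma_additive.

Let step_sigma_finite : sigma_finite setT lebesgue_step.
Proof.
have /sigma_finiteP[F [TF ndF Foo]] := sigma_finiteT (@lebesgue_measure R).
have /sigma_finiteP[G [TG ndG Goo]] := sigma_finiteT m.
exists (fun k => @uncons_rV n @^-1` (F k `*` G k)).
  apply/seteqP; split=> // v _.
  have [i _ Fi] : (\bigcup_k F k) (uncons_rV v).1 by rewrite -TF.
  have [j _ Gj] : (\bigcup_k G k) (uncons_rV v).2 by rewrite -TG.
  exists (maxn i j) => //; split.
    exact: (subsetPset _ _ (ndF _ _ (leq_maxl i j))).
  exact: (subsetPset _ _ (ndG _ _ (leq_maxr i j))).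
move=> k; have [mF Fk] := Foo k; have [mG Gk] := Goo k; split.
  rewrite -[X in measurable X]setTI; apply: measurable_uncons_rV => //.
  exact: measurableX.
rewrite /lebesgue_step /pushforward -comp_preimage.
rewrite (_ : _ \o _ = id); last by apply/funext => x; exact: cons_rVK.
rewrite preimage_id /prod /= product_measure1E//.
by rewrite lte_mul_pinfty// ge0_fin_numE.
Qed.

HB.instance Definition _ := Measure_isSigmaFinite.Build _ _ _
  lebesgue_step step_sigma_finite.

End step.

Fixpoint lebesgue_rV n : {sigma_finite_measure set 'rV[R]_n -> \bar R} :=
  if n is n'.+1 then lebesgue_step (lebesgue_rV n') else dirac (0 : 'rV[R]_0).

Lemma lebesgue_rV_box n (A : 'I_n -> set R) :
  (forall i, measurable (A i)) ->
  (lebesgue_rV n [set v | forall i, A i (v ord0 i)] =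
   \prod_(i < n) (lebesgue_measure (A i : set T1)))%E.
Proof.
elim: n A => [|n IHn] A mA.
  by rewrite big_ord0 /= diracE mem_set// => -[].
rewrite big_ord_recl -IHn//= /lebesgue_step /pushforward.
rewrite -product_measure1E; first last.
- exact: (measurable_box (A := fun i => A (lift ord0 i))).
- exact: (mA ord0).
congr (product_measure1 _ _ _); apply/seteqP.
split => [[x v] /= xv|[x v] /= [xA vA] i].
  split; first by have := xv ord0; rewrite mxE unlift_none.
  by move=> i; have := xv (lift ord0 i); rewrite mxE liftK.
by case: (unliftP ord0 i) => [j|] ->; rewrite mxE ?liftK ?unlift_none.
Qed.

End lebesgue_rV.

Section calculus.
Variables (R : realType) (n : nat).
Implicit Types (f : 'rV[R]_n -> R) (i : 'I_n).

Definition enorm (v : 'rV[R]_n) : R := Num.sqrt (\sum_i v ord0 i ^+ 2).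

Definition partial i f : 'rV[R]_n -> R := fun x => 'D_(delta_mx ord0 i) f x.

Definition gradient f : 'rV[R]_n -> 'rV[R]_n := fun x => \row_i partial i f x.

Fixpoint Ck (k : nat) f : Prop :=
  continuous f /\
  if k is k'.+1 then
    forall i, (forall x, derivable f x (delta_mx ord0 i)) /\ Ck k' (partial i f)
  else True.

Definition test_function (Omega : set 'rV[R]_n) f : Prop :=
  let supp := closure [set x | f x != 0] in
  [/\ forall k, Ck k f, compact supp & supp `<=` Omega].

End calculus.

(* Near each boundary point, up to relabelling and reorienting the coordinate
   axes, [Omega] is the region above the graph of a C^2 function of the
   remaining n - 1 coordinates [col' i x]. *)
Definition C2_boundary (R : realType) n (Omega : set 'rV[R]_n) : Prop :=
  forall x0, (closure Omega `\` interior Omega) x0 ->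
  exists (i : 'I_n) (s : bool) (gamma : 'rV[R]_n.-1 -> R),
    Ck 2 gamma /\
    \forall x \near x0, Omega x <-> gamma (col' i x) < (-1) ^+ s * x ord0 i.

Section sobolev.
Variables (R : realType) (N : nat) (Omega : set 'rV[R]_N).
Implicit Types (u phi : 'rV[R]_N -> R) (g : 'rV[R]_N -> 'rV[R]_N) (p q r : R).

Local Notation mu := (lebesgue_rV R N).

(* Functions on [Omega] are represented by functions on R^N whose values outside
   [Omega] are irrelevant: they are replaced by 0 through [f \_ Omega]. *)
Definition in_Lp r u : Prop := u \_ Omega \in Lfun mu r%:E.

Definition Lp_norm r u : \bar R := Lnorm mu r%:E (EFin \o (u \_ Omega)).

Definition weak_gradient u g : Prop :=
  forall phi, test_function Omega phi -> forall i,
    \int[mu]_(x in Omega) (u x * partial i phi x) =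
    - \int[mu]_(x in Omega) (g x ord0 i * phi x).

Definition sobolev p u g : Prop :=
  [/\ in_Lp p u, forall i, in_Lp p (fun x => g x ord0 i) & weak_gradient u g].

(* W_0^{1,p} is the closure of the test functions in W^{1,p}. An element is
   given by a representative of its a.e. class, together with a representative
   of its weak gradient, the latter being determined a.e. by the former. *)
Record W01p p := MkW01p {
  W01p_fun :> 'rV[R]_N -> R ;
  wgrad : 'rV[R]_N -> 'rV[R]_N ;
  W01p_sobolev : sobolev p W01p_fun wgrad ;
  W01p_closure : exists phi : nat -> 'rV[R]_N -> R,
    [/\ forall k, test_function Omega (phi k),
        Lp_norm p (fun x => W01p_fun x - phi k x) @[k --> \oo] --> 0%E &
        Lp_norm p (fun x => enorm (wgrad x - gradient (phi k) x))
          @[k --> \oo] --> 0%E] }.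

Definition W01p_nonzero p (u : W01p p) : Prop :=
  ~ {ae mu, forall x, Omega x -> u x = 0}.

Variables (p q : R) (a : 'rV[R]_N -> R).
Implicit Types (lambda : R) (w : W01p p).

Definition energy lambda w : R :=
  \int[mu]_(x in Omega) (enorm (wgrad w x) `^ p)
  - lambda * \int[mu]_(x in Omega) (`|w x| `^ p).

Definition weighted_int w : R := \int[mu]_(x in Omega) (a x * `|w x| `^ q).

Definition functional lambda w : R :=
  p^-1 * energy lambda w - q^-1 * weighted_int w.

Definition nehari lambda : set (W01p p) :=
  [set w | W01p_nonzero w /\ energy lambda w = weighted_int w].

Definition ground_level lambda : \bar R :=
  ereal_inf [set (functional lambda w)%:E | w in nehari lambda].

Definition lambda_star : R :=
  inf [set fine (Lp_norm p (fun x => enorm (wgrad w x))) `^ p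
           / fine (Lp_norm p w) `^ p
      | w in [set w | W01p_nonzero w /\ 0 <= weighted_int w]].

Definition sign_changing : Prop :=
  (exists2 x, Omega x & 0 < a x) /\ (exists2 x, Omega x & a x < 0).

End sobolev.

(* Main.v *)
Require Import Defs.
From mathcomp Require Import all_boot all_order all_algebra.
From mathcomp Require Import all_classical all_reals all_analysis.
From mathcomp Require Import measurable_realfun ring lra.
Import Order.TTheory GRing.Theory Num.Theory.
Import numFieldNormedType.Exports.

Set Implicit Arguments.
Unset Strict Implicit.
Unset Printing Implicit Defensive.

Local Open Scope classical_set_scope.
Local Open Scope ring_scope.

(** Write G(u), P(u) and A(u) for the integrals over Omega of |grad u|^p, |u|^p
    and a |u|^q, and E_l = G - l P.  On the Nehari set E_l = A, so there the
    functional equals - c A with c = 1/q - 1/p > 0, and only functions with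
    A > 0 can make the level negative.  If A(u) > 0 and E_l(u) > 0, exactly one
    positive multiple of u is on the Nehari set, and the functional takes there
    the value - c Q^(- q / (p - q)), where Q = E_l(u) / A(u)^(p/q) is invariant
    under scaling.  Hence for l <= lambda_star, where E_l >= 0 on {A > 0},
    the level is F(kappa(l)): kappa(l) is the infimum of Q over {A > 0}, and
    F(x) = - c x^(- q / (p - q)) for x > 0, F = -oo elsewhere
    ([level_kappa]).  The function F is continuous on the whole line and
    increasing on [0, +oo[, so everything reduces to kappa.

    - kappa decreases strictly, at a rate bounded below, because
      P >= d A^(p/q) on {A > 0} for some d > 0.
    - kappa is continuous below lambda_star: for l <= m < lambda_star the energy
      E_m is a convex combination of E_l and of E_lambda_star >= 0, so kappa(m)
      lies between kappa(l) (lambda_star - m) / (lambda_star - l) and kappa(l).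
    - kappa is left-continuous at lambda_star, because it is nonincreasing
      and an infimum of continuous (indeed affine) functions of l.

    For arbitrary l <= m, the inequality E_m <= E_l shows that a function on the
    Nehari set of l does at least as well at m after rescaling, unless
    E_m(u) <= 0 < A(u).  In that case the level at m is -oo
    ([level_eq_Ny]): by [small_energy] there are functions with A bounded below
    by A(u) / 2 and with arbitrarily small positive energy.  They are found on
    the segment from u to u + phi, where phi is tiny in L^p but has a huge
    gradient; Minkowski's inequality controls A along the segment, and the
    energy, being continuous, becomes positive through small values.  Such phi
    are test functions multiplied by sin (k x_i) or cos (k x_i)
    ([oscillating_test_function]).  The same argument shows that the Nehari
    set is never empty and the level always negative.

    What remains is the construction of W_0^{1,p} functions: smooth bumps exist
    ([bump_function]), test functions have their gradient as weak gradient since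
    the partial derivatives of a compactly supported function have integral zero
    ([integral_partial_eq0]), and W_0^{1,p} is closed under linear
    combinations ([W01p_lin]). *)

(** * Real powers and the profile of the ground level *)

Lemma continuous_powR_gt0 (R : realType) (r x : R) : 0 < x ->
  {for x, continuous (fun y : R => y `^ r)}.
Proof.
move=> x0; apply: differentiable_continuous; apply/derivable1_diffP.
by apply: derivable_powR; rewrite in_itv/= x0.
Qed.

Lemma powRVK (R : realType) (r x : R) : 0 < r -> 0 <= x ->
  (x `^ r^-1) `^ r = x.
Proof. by move=> r0 x0; rewrite -powRrM mulVf ?gt_eqF// powRr1. Qed.

Lemma powRD_gt0 (R : realType) (x r s : R) : 0 < x ->
  x `^ (r + s) = x `^ r * x `^ s.
Proof. by move=> x0; rewrite powRD// (gt_eqF x0) implybT. Qed.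

Lemma powR_le1 (R : realType) (q x : R) :
  0 <= q -> 0 <= x -> x <= 1 -> x `^ q <= 1.
Proof.
move=> q0 x0 x1.
have := ge0_ler_powR q0 (_ : x \in Num.nneg) (_ : 1 \in Num.nneg) x1.
by rewrite powR1 !nnegrE; apply.
Qed.

Lemma powR_le1D (R : realType) (q r x : R) : 0 <= q -> q <= r -> 0 <= x ->
  x `^ q <= 1 + x `^ r.
Proof.
move=> q0 qr x0; have [x1|x1] := leP x 1.
  apply: (@le_trans _ _ 1); last by rewrite lerDl powR_ge0.
  exact: powR_le1.
apply: (@le_trans _ _ (x `^ r)); last by rewrite lerDr.
by rewrite ler_powR// ltW.
Qed.

Lemma continuous_norm_powR (R : realType) (r : R) : 0 < r ->
  continuous (fun x : R => `|x| `^ r).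
Proof.
move=> r0 x; have [->|x0] := eqVneq x 0.
  apply/cvgrPdist_lt => e e0; rewrite normr0 powR0 ?gt_eqF//.
  near=> y; rewrite sub0r normrN ger0_norm ?powR_ge0//.
  rewrite -[ltRHS](@powRVK _ r e) ?ltW//.
  rewrite gt0_ltr_powR ?nnegrE ?powR_ge0//.
  rewrite -[y]subr0 distrC.
  by near: y; apply: cvgr_dist_lt; [exact: cvg_id|exact: powR_gt0].
apply: (@continuous_comp _ _ _ (fun y : R => `|y|) (fun y : R => y `^ r)).
  exact: norm_continuous.
by apply: continuous_powR_gt0; rewrite normr_gt0.
Unshelve. all: by end_near. Qed.

(** The ground level as a function of the best constant in the inequality E_l
    >= k A^(p/q) on {A > 0}; without a positive constant the functional is
    unbounded below. *)
Section level_profile.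
Variables (R : realType) (c b : R).
Hypotheses (c_gt0 : 0 < c) (b_gt0 : 0 < b).

Definition level_profile (x : R) : \bar R :=
  if 0 < x then (- (c * x `^ (- b)))%:E else -oo%E.

Lemma level_profile_lt x y : 0 <= x -> x < y ->
  (level_profile x < level_profile y)%E.
Proof.
move=> x0 xy; have y0 : 0 < y by exact: le_lt_trans xy.
rewrite /level_profile y0; case: ifPn => [{}x0|_]; last exact: ltNyr.
rewrite lte_fin ltrN2 ltr_pM2l// !powRN ltf_pV2 ?posrE ?powR_gt0//.
by rewrite gt0_ltr_powR// nnegrE ltW.
Qed.

Lemma level_profile_small y : exists2 e, 0 < e &
  forall x, x <= e -> (level_profile x <= y%:E)%E.
Proof.
pose Y := `|y| + 1; have Y0 : 0 < Y by rewrite ltr_wpDl.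
exists ((c / Y) `^ b^-1); first by rewrite powR_gt0// divr_gt0.
move=> x xe; rewrite /level_profile; case: ifPn => [x0|_]; last exact: leNye.
rewrite lee_fin lerNl; apply: (@le_trans _ _ Y).
  by rewrite /Y (le_trans (ler_norm _))// normrN lerDl.
have : x `^ b <= c / Y.
  rewrite -[leRHS](@powRVK _ b (c / Y)) ?divr_ge0 ?(ltW c_gt0) ?(ltW Y0)//.
  by rewrite ge0_ler_powR ?nnegrE ?powR_ge0 ?(ltW x0) ?(ltW b_gt0).
rewrite ler_pdivlMr// mulrC -ler_pdivlMr ?powR_gt0// => /le_trans; apply.
by rewrite powRN.
Qed.

(** The two branches match at 0 because x^(- b) blows up there. *)
Lemma level_profile_continuous : continuous level_profile.
Proof.
move=> x; have [x0|x0] := ltP 0 x.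
  have h : (- (c * y `^ (- b)))%:E @[y --> x] --> (- (c * x `^ (- b)))%:E.
    apply: cvg_EFin; first by near=> y.
    apply: cvgN; apply: cvgMl_tmp; exact: continuous_powR_gt0.
  rewrite /continuous_at {2}/level_profile x0; apply: cvg_trans h.
  apply: near_eq_cvg; near=> y.
  rewrite /level_profile ifT//; near: y; exact: lt_nbhsr.
rewrite /continuous_at {2}/level_profile ltNge x0/=.
apply/cvgeNyPle => y; have [e e0 h] := level_profile_small y.
near=> z; apply: h; apply: ltW; near: z; apply: lt_nbhsl.
exact: le_lt_trans e0.
Unshelve. all: by end_near. Qed.

End level_profile.

(** * Ground levels on an abstract Nehari set *)

(** What the argument uses about the three integrals is their homogeneity, the
    bound of A by P, the inequality E_ls >= 0 on {A > 0}, where [ls] stands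
    for lambda_star, and the possibility of making the energy positive and
    small while keeping A away from 0. *)
Section abstract_nehari.
Variables (R : realType) (W : Type) (nonzero : W -> Prop) (G P A : W -> R).
Variables (p q ls : R).
Hypotheses (q_gt1 : 1 < q) (q_lt_p : q < p).
Let E l u := G u - l * P u.
Hypothesis nonzeroW : forall u, 0 < A u -> nonzero u.
Hypothesis scaleW : forall u t, 0 < t ->
  exists v, [/\ G v = t `^ p * G u, P v = t `^ p * P u & A v = t `^ q * A u].
Hypothesis P_lower : exists2 d, 0 < d &
  forall u, 0 < A u -> d * A u `^ (p / q) <= P u.
Hypothesis A_pos : exists u, 0 < A u.
Hypothesis small_energy : forall l u e, 0 < A u -> E l u <= 0 -> 0 < e ->
  exists v, [/\ A u / 2 <= A v, 0 < E l v & E l v <= e].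
Hypothesis ls_le : forall u, 0 < A u -> ls * P u <= G u.

Let M l : \bar R := ereal_inf
  [set (p^-1 * E l u - q^-1 * A u)%:E
     | u in [set u | nonzero u /\ E l u = A u]].
Let al := p / (p - q).
Let be := q / (p - q).
Let c := q^-1 - p^-1.

Let q_gt0 : 0 < q. Proof. exact: lt_trans q_gt1. Qed.
Let p_gt0 : 0 < p. Proof. exact: lt_trans q_lt_p. Qed.
Let pq_gt0 : 0 < p - q. Proof. by rewrite subr_gt0. Qed.
Let be_gt0 : 0 < be. Proof. exact: divr_gt0. Qed.
Let c_gt0 : 0 < c. Proof. by rewrite subr_gt0 ltf_pV2. Qed.
Let al_be : al = 1 + be.
Proof. by rewrite /al /be; field; rewrite gt_eqF. Qed.

(* Both E_l and A^(p/q) are homogeneous of degree p. *)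
Let quotient l u := E l u / A u `^ (p / q).

Let E_quotient l u : 0 < A u -> E l u = quotient l u * A u `^ (p / q).
Proof. by move=> Au; rewrite /quotient divfK// gt_eqF// powR_gt0. Qed.

Let value_quotient l u : 0 < A u -> 0 < E l u ->
  c * (A u `^ al * E l u `^ (- be)) = c * quotient l u `^ (- be).
Proof.
move=> Au Eu; have Q0 : 0 < quotient l u by rewrite divr_gt0// powR_gt0.
congr (_ * _); rewrite (E_quotient l Au) powRM ?ltW ?powR_gt0//.
rewrite mulrCA -powRrM -powRD_gt0//.
have -> : al + p / q * - be = 0 by rewrite /al /be; field; rewrite !gt_eqF.
by rewrite powRr0 mulr1.
Qed.

(** The multiple t u with t^(p - q) = A(u) / E_l(u) is on the Nehari set, and
    the functional takes there the value - (1/q - 1/p) A(t u). *)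
Lemma level_le l u : 0 < A u -> 0 < E l u ->
  (M l <= (- (c * quotient l u `^ (- be)))%:E)%E.
Proof.
move=> Au Eu; pose t := (A u / E l u) `^ (p - q)^-1.
have AE0 : 0 < A u / E l u by rewrite divr_gt0.
have t0 : 0 < t by rewrite powR_gt0.
have [v [Gv Pv Av]] := scaleW u t0.
have Ev : E l v = t `^ p * E l u by rewrite /E Gv Pv; ring.
have tpq : t `^ p = t `^ q * (A u / E l u).
  rewrite -[in RHS](@powRVK _ (p - q) (A u / E l u)) ?(ltW AE0)//.
  rewrite -powRD_gt0//.
  by congr (_ `^ _); ring.
have EA : E l v = A v.
  by rewrite Ev Av tpq -mulrA divfK// gt_eqF.
apply: ereal_inf_lbound; exists v.
  by split=> //; apply: nonzeroW; rewrite Av mulr_gt0// powR_gt0.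
congr EFin; rewrite EA -value_quotient// Av.
have -> : t `^ q = A u `^ be * E l u `^ (- be).
  rewrite /t -powRrM (mulrC _ q) -/be powRM ?invr_ge0 ?ltW//.
  by rewrite -(powR_inv1 (ltW Eu)) -powRrM mulN1r.
have -> : A u `^ al = A u * A u `^ be.
  rewrite al_be powRD_gt0//.
  by rewrite powRr1 ?(ltW Au).
by rewrite /c; ring.
Qed.

(** The case E_l(u) <= 0 < A(u) is turned into a positive energy by a
    perturbation of u, so that the Nehari set always has points with A > 0. *)
Lemma level_lt0 l : (M l < 0)%E.
Proof.
have [u Au] := A_pos.
have [v [Av Ev]] : exists v, 0 < A v /\ 0 < E l v.
  have [Eu|Eu] := ltP 0 (E l u); first by exists u.
  have [v [h1 h2 _]] := small_energy Au Eu ltr01.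
  by exists v; split=> //; apply: lt_le_trans h1; rewrite divr_gt0.
apply: le_lt_trans (level_le Av Ev) _.
by rewrite lte_fin oppr_lt0 mulr_gt0// powR_gt0// divr_gt0// powR_gt0.
Qed.

(** Perturbations of u have a positive energy as small as desired and A
    bounded below, so their quotients tend to 0 and the values on the Nehari
    set to -oo. *)
Lemma level_eq_Ny l u : 0 < A u -> E l u <= 0 -> M l = -oo%E.
Proof.
move=> Au Eu; apply: eq_ninfty => y.
have [e e0 small] := level_profile_small c_gt0 be_gt0 y.
have Au2 : 0 < A u / 2 by rewrite divr_gt0.
have [v [Av Ev Eve]] :=
  small_energy Au Eu (mulr_gt0 e0 (powR_gt0 (p / q) Au2)).
have Av0 : 0 < A v by exact: lt_le_trans Av.
apply: le_trans (level_le Av0 Ev) _.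
have Q0 : 0 < quotient l v by rewrite divr_gt0// powR_gt0.
have := small (quotient l v); rewrite /level_profile Q0; apply.
rewrite ler_pdivrMr ?powR_gt0//; apply: le_trans Eve _.
rewrite ler_pM2l// ge0_ler_powR ?nnegrE ?(ltW Au2) ?(ltW Av0)//.
by rewrite divr_ge0 ?ltW.
Qed.

(** On the Nehari set the functional is - (1/q - 1/p) A, which is nonnegative
    wherever A <= 0; so a bound x <= 0 has to be checked only where A > 0. *)
Lemma level_ge l x : (forall u, 0 < A u -> 0 < E l u ->
    x <= - (c * quotient l u `^ (- be))) -> x <= 0 -> (x%:E <= M l)%E.
Proof.
move=> h x0; apply: le_ereal_inf_tmp => _ [u [_ Eu] <-].
rewrite Eu lee_fin; have [Au|Au] := ltP 0 (A u).
  apply: le_trans (h u Au _) _; first by rewrite Eu.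
  have := @value_quotient l u Au; rewrite Eu => <-//.
  by rewrite -powRD_gt0// al_be addrK powRr1 ?(ltW Au)// /c; lra.
apply: le_trans x0 _; rewrite -mulrBl mulr_le0//.
by rewrite subr_le0 ltW// -subr_gt0.
Qed.

(** Since E_m <= E_l, rescaling a point of the Nehari set of l to that of m
    lowers the functional; if E_m <= 0 no rescaling exists, but then
    [level_eq_Ny] applies. *)
Lemma level_nonincreasing l m : l <= m -> (M m <= M l)%E.
Proof.
move=> lm; apply: le_ereal_inf_tmp => _ [u [nzu Eu] <-].
rewrite Eu; have [Au|Au] := ltP 0 (A u); last first.
  apply: le_trans (ltW (level_lt0 m)) _; rewrite lee_fin.
  by rewrite -mulrBl mulr_le0// subr_le0 ltW// -subr_gt0.
have [Em|Em] := leP (E m u) 0; first by rewrite (level_eq_Ny Au Em) leNye.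
apply: le_trans (level_le Au Em) _; rewrite lee_fin.
have P0 : 0 <= P u.
  have [d d0 /(_ u Au)] := P_lower.
  by apply: le_trans; rewrite mulr_ge0 ?powR_ge0 ?ltW.
have -> : p^-1 * A u - q^-1 * A u = - (c * quotient l u `^ (- be)).
  rewrite -value_quotient ?Eu//.
  by rewrite -powRD_gt0// al_be addrK powRr1 ?(ltW Au)// /c; lra.
have Qm : 0 < quotient m u by rewrite divr_gt0// powR_gt0.
have Ql : 0 < quotient l u by rewrite divr_gt0 ?powR_gt0// Eu.
rewrite lerN2 ler_pM2l// !powRN lef_pV2 ?posrE ?powR_gt0//.
rewrite ge0_ler_powR ?nnegrE ?(ltW be_gt0) ?(ltW Ql) ?(ltW Qm)//.
by rewrite ler_pM2r ?invr_gt0 ?powR_gt0// lerB// ler_wpM2r.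
Qed.

(* kappa(l) is the best constant in E_l >= k A^(p/q) on {A > 0}; it is used for
   l <= ls only, where the quotients are nonnegative. *)
Let Q l : set R := [set quotient l u | u in [set u | 0 < A u]].
Let kappa l : R := inf (Q l).

Let P0 u : 0 < A u -> 0 <= P u.
Proof.
have [d d0 h] := P_lower => Au.
by apply: le_trans (h _ Au); rewrite mulr_ge0 ?powR_ge0 ?ltW.
Qed.

Let Q_ge0 l x : l <= ls -> Q l x -> 0 <= x.
Proof.
move=> lls [u /= Au <-]; rewrite divr_ge0 ?powR_ge0// subr_ge0.
by apply: le_trans (ls_le Au); rewrite ler_wpM2r// P0.
Qed.

Let Q_neq0 l : Q l !=set0.
Proof. by have [u Au] := A_pos; exists (quotient l u), u. Qed.

Let kappa_ge0 l : l <= ls -> 0 <= kappa l.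
Proof. by move=> lls; apply: lb_le_inf => // x; apply: Q_ge0. Qed.

Let kappa_le l u : l <= ls -> 0 < A u -> kappa l <= quotient l u.
Proof.
move=> lls Au; apply: ge_inf; last by exists u.
by exists 0 => x; apply: Q_ge0.
Qed.

Let kappa_ge l x : (forall u, 0 < A u -> x <= quotient l u) -> x <= kappa l.
Proof. by move=> h; apply: lb_le_inf => // _ [u Au <-]; exact: h. Qed.

(** The values - c Q^(- be) are increasing in Q, so their infimum is reached
    along quotients that tend to kappa. If kappa = 0, either some energy is
    nonpositive or the quotients come arbitrarily close to 0 from above; the
    level is -oo in both cases. *)
Lemma level_kappa l : l <= ls -> M l = level_profile c be (kappa l).
Proof.
move=> lls; rewrite /level_profile; case: ifPn => [k0|].
  apply/eqP; rewrite eq_le; apply/andP; split; last first.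
    apply: level_ge; last by rewrite oppr_le0 mulr_ge0 ?powR_ge0 ?ltW.
    move=> u Au Eu; have Qu := kappa_le lls Au.
    rewrite lerN2 ler_pM2l// !powRN lef_pV2 ?posrE ?powR_gt0//; last first.
      exact: lt_le_trans Qu.
    rewrite ge0_ler_powR ?nnegrE ?(ltW be_gt0)// ltW//.
    exact: lt_le_trans Qu.
  have lim : (level_profile c be x @[x --> (kappa l)^'+] -->
      level_profile c be (kappa l))%E.
    by apply: cvg_at_right_filter; exact: level_profile_continuous.
  have -> : (- (c * kappa l `^ (- be)))%:E = level_profile c be (kappa l).
    by rewrite /level_profile k0.
  apply: (@cvge_ge _ _ _ _ _ _ _ _ lim).
  near=> x.
  have : inf (Q l) < x by [].
  move=> /inf_lt; case => //.
  move=> _ [u /= Au <-] ux.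
  have Eu : 0 < E l u.
    rewrite (E_quotient l Au) mulr_gt0 ?powR_gt0//.
    exact: lt_le_trans k0 (kappa_le lls Au).
  apply: le_trans (level_le Au Eu) _.
  have Qu0 : 0 < quotient l u by rewrite divr_gt0// powR_gt0.
  apply/ltW; have := level_profile_lt c_gt0 be_gt0 (ltW Qu0) ux.
  by rewrite /level_profile Qu0.
rewrite -leNgt => k0; apply: eq_ninfty => y.
have [e e0 small] := level_profile_small c_gt0 be_gt0 y.
have : inf (Q l) < e by exact: le_lt_trans e0.
move=> /inf_lt; case => //.
move=> _ [u /= Au <-] ue; have [Eu|Eu] := leP (E l u) 0.
  by rewrite (level_eq_Ny Au Eu) leNye.
apply: le_trans (level_le Au Eu) _.
have Qu0 : 0 < quotient l u by rewrite divr_gt0// powR_gt0.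
by have := small _ (ltW ue); rewrite /level_profile Qu0.
Unshelve. all: by end_near. Qed.

(* From l to m each quotient drops by (m - l) P / A^(p/q) >= (m - l) d. *)
Let kappa_decr l m : l < m -> m <= ls -> kappa m < kappa l.
Proof.
move=> lm mls; have [d d0 dP] := P_lower.
apply: (@lt_le_trans _ _ (kappa m + (m - l) * d)).
  by rewrite ltrDl mulr_gt0// subr_gt0.
apply: kappa_ge => u Au.
apply: (@le_trans _ _ (quotient m u + (m - l) * d)).
  by rewrite lerD2r kappa_le.
rewrite /quotient ler_pdivlMr ?powR_gt0// mulrDl divfK ?gt_eqF ?powR_gt0//.
rewrite -mulrA; apply: (@le_trans _ _ (E m u + (m - l) * P u)).
  by rewrite lerD2l ler_pM2l ?subr_gt0// dP.
by rewrite /E; lra.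
Qed.

Lemma level_decreasing l m : l < m -> m <= ls -> (M m < M l)%E.
Proof.
move=> lm mls; rewrite !level_kappa//; last by rewrite ltW// (lt_le_trans lm).
by apply: level_profile_lt => //; [exact: kappa_ge0|exact: kappa_decr].
Qed.

Let kappa_nincr l m : l <= m -> m <= ls -> kappa m <= kappa l.
Proof.
by rewrite le_eqVlt => /predU1P[->//|lm mls]; exact/ltW/kappa_decr.
Qed.

(* E_m is the convex combination of E_l and E_ls with weights
   (ls - m) / (ls - l) and (m - l) / (ls - l), and E_ls >= 0 on {A > 0}. *)
Let kappa_ratio l m : l <= m -> m < ls ->
  kappa l * ((ls - m) / (ls - l)) <= kappa m.
Proof.
move=> lm mls; have lls : l < ls by exact: le_lt_trans mls.
apply: kappa_ge => u Au.
apply: (@le_trans _ _ (quotient l u * ((ls - m) / (ls - l)))).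
  rewrite ler_wpM2r ?kappa_le//; last exact: ltW.
  by rewrite divr_ge0// subr_ge0 ltW.
rewrite /quotient mulrAC ler_pM2r ?invr_gt0 ?powR_gt0//.
rewrite mulrA ler_pdivrMr ?subr_gt0// -subr_ge0.
have -> : E m u * (ls - l) - E l u * (ls - m) =
   (m - l) * (G u - ls * P u) by rewrite /E; ring.
by rewrite mulr_ge0// subr_ge0// ls_le.
Qed.

Let kappa_continuous l : l < ls -> {for l, continuous kappa}.
Proof.
move=> lls; pose r m := (ls - m) / (ls - l).
have r1 : r m @[m --> l] --> (1 : R).
  rewrite -[X in _ --> X](@mulfV _ (ls - l)) ?gt_eqF ?subr_gt0//.
  by apply: cvgMr_tmp; apply: cvgB; [exact: cvg_cst|exact: cvg_id].
have r1_0 : `|r m - 1| @[m --> l] --> (0 : R).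
  rewrite -(normr0 R) -(subrr (1 : R)); apply: cvg_norm.
  by apply: cvgB; [exact: r1|exact: cvg_cst].
rewrite /continuous_at.
apply: (@squeeze_cvgr _ _ _ _ (fun m => kappa l * (1 - `|r m - 1|))
  (fun m => kappa l * (1 + `|r m - 1|))).
- near=> m.
  have mls : m < ls by near: m; exact: lt_nbhsl.
  have rm0 : 0 < r m by rewrite divr_gt0 ?subr_gt0.
  have kl0 := kappa_ge0 (ltW lls); have km0 := kappa_ge0 (ltW mls).
  have [lm|ml] := leP l m.
    have rm1 : r m <= 1 by rewrite ler_pdivrMr ?subr_gt0// mul1r lerB.
    rewrite ler0_norm ?subr_le0// opprB subKr kappa_ratio//=.
    rewrite (le_trans (kappa_nincr lm (ltW mls)))// ler_peMr//.
    by rewrite lerDl subr_ge0.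
  have rm1 : 1 <= r m by rewrite ler_pdivlMr ?subr_gt0// mul1r lerB// ltW.
  rewrite ger0_norm ?subr_ge0// (addrC 1 (r m - 1)) subrK; apply/andP; split.
    rewrite (le_trans _ (kappa_nincr (ltW ml) (ltW lls)))// ler_piMr//.
    by rewrite gerBl subr_ge0.
  have := kappa_ratio (ltW ml) lls.
  have -> : (ls - l) / (ls - m) = (r m)^-1 by rewrite invf_div.
  by rewrite ler_pdivrMr.
- have : kappa l * (1 - `|r m - 1|) @[m --> l] --> kappa l * (1 - 0).
    by apply: cvgMl_tmp; apply: cvgB; [exact: cvg_cst|exact: r1_0].
  by rewrite subr0 mulr1.
- have : kappa l * (1 + `|r m - 1|) @[m --> l] --> kappa l * (1 + 0).
    by apply: cvgMl_tmp; apply: cvgD; [exact: cvg_cst|exact: r1_0].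
  by rewrite addr0 mulr1.
Unshelve. all: by end_near. Qed.

Lemma level_continuous l : l < ls -> {for l, continuous M}.
Proof.
move=> lls; suff : M m @[m --> l] --> M l by [].
rewrite level_kappa ?ltW//.
apply: (@cvg_trans _ (level_profile c be (kappa m) @[m --> l])).
  apply: near_eq_cvg; near=> m; rewrite level_kappa// ltW//.
  by near: m; exact: lt_nbhsl.
apply: (@continuous_comp _ _ _ kappa (level_profile c be)).
  exact: kappa_continuous.
exact: level_profile_continuous.
Unshelve. all: by end_near. Qed.

(* A single almost optimal u for ls bounds kappa from above near ls, because
   its quotient is continuous in l; monotonicity gives the lower bound. *)
Let kappa_left : kappa l @[l --> ls^'-] --> kappa ls.
Proof.
apply/cvgrPdist_lt => e e0.
have : inf (Q ls) < kappa ls + e by rewrite ltrDl.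
move=> /inf_lt; case => //.
move=> _ [u /= Au <-] ue.
have quot : quotient l u @[l --> ls^'-] --> quotient ls u.
  apply: cvg_at_left_filter; apply: cvgMr_tmp; apply: cvgB.
    exact: cvg_cst.
  by apply: cvgMr_tmp; exact: cvg_id.
near=> l.
have lls : l < ls by [].
rewrite distrC ger0_norm ?subr_ge0 ?kappa_nincr ?(ltW lls)//.
rewrite ltrBlDl; apply: (@le_lt_trans _ _ (quotient l u)).
  by rewrite kappa_le ?ltW.
by near: l; apply: (cvgr_lt (quotient ls u)).
Unshelve. all: by end_near. Qed.

Lemma level_left_continuous : M l @[l --> ls^'-] --> M ls.
Proof.
rewrite level_kappa//.
apply: (@cvg_trans _ (level_profile c be (kappa m) @[m --> ls^'-])).
  by apply: near_eq_cvg; near=> m; rewrite level_kappa// ltW.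
apply: (@cvg_comp _ _ _ kappa (level_profile c be) _ _ _ kappa_left).
exact: level_profile_continuous.
Unshelve. all: by end_near. Qed.

End abstract_nehari.

(** * Seminorms of Lebesgue spaces on a domain *)

(** A real number, hence convenient for estimates; it is the L^r norm for
    functions in L^r and the junk value 0 when the norm is infinite. *)
Section lp_seminorm.
Variables (R : realType) (N : nat) (Omega : set 'rV[R]_N).
Hypothesis mOmega : measurable Omega.
Implicit Types (u v : 'rV[R]_N -> R) (r s t : R).

Local Notation mu := (lebesgue_rV R N).
Local Notation in_Lp := (in_Lp Omega).
Local Notation Lp_norm := (Lp_norm Omega).

Definition lp_seminorm r u : R := fine (Lp_norm r u).

Lemma in_LpP r u : in_Lp r u <->
  measurable_fun Omega u /\ (Lp_norm r u < +oo)%E.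
Proof.
rewrite /Defs.in_Lp inE; split.
  move=> /andP[/[!inE] mu' fu]; split => //.
  exact/(measurable_restrictT _ mOmega).
move=> [mu' fu]; apply/andP; rewrite !inE; split => //=.
by apply/(measurable_restrictT _ mOmega).
Qed.

Lemma in_Lp_measurable r u : in_Lp r u -> measurable_fun Omega u.
Proof. by move=> /in_LpP[]. Qed.

Lemma lp_seminorm_ge0 r u : 0 <= lp_seminorm r u.
Proof. by rewrite fine_ge0// Lnorm_ge0. Qed.

Lemma lp_seminormE r u : in_Lp r u -> Lp_norm r u = (lp_seminorm r u)%:E.
Proof.
move=> /in_LpP[_ h]; rewrite /lp_seminorm fineK//.
by rewrite ge0_fin_numE ?Lnorm_ge0.
Qed.

Lemma Lp_norm_integral r u : r != 0 ->
  (Lp_norm r u = (\int[mu]_(x in Omega) (`|u x| `^ r)%:E) `^ r^-1)%E.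
Proof.
move=> r0; rewrite /Defs.Lp_norm unlock [in RHS]integral_mkcond.
congr (_ `^ _)%E.
apply: eq_integral => x _; rewrite /patch /=; case: ifPn => // _.
by rewrite normr0 powR0.
Qed.

Lemma measurable_norm_powR u r : measurable_fun Omega u ->
  measurable_fun Omega (fun x => `|u x| `^ r).
Proof.
move=> mu'; apply: (measurableT_comp (measurable_powR _)) => //.
exact: measurableT_comp.
Qed.

Lemma in_Lp_integrable r u : 0 < r -> in_Lp r u <->
  measurable_fun Omega u /\ mu.-integrable Omega (fun x => (`|u x| `^ r)%:E).
Proof.
move=> r0; have rN0 : r != 0 by rewrite gt_eqF.
have ge0 x : Omega x -> (0 <= (`|u x| `^ r)%:E)%E.
  by move=> _; rewrite lee_fin powR_ge0.
split.
  move=> /in_LpP[mu' h]; split=> //; apply/integrableP; split.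
    by apply/measurable_EFinP; exact: measurable_norm_powR.
  under eq_integral do rewrite gee0_abs ?lee_fin ?powR_ge0//.
  apply: (@lty_poweRy _ _ r^-1); first by rewrite invr_eq0.
  by rewrite -Lp_norm_integral.
move=> [mu' /integrableP[_ h]]; apply/in_LpP; split=> //.
rewrite Lp_norm_integral// poweR_lty//; move: h.
by under eq_integral do rewrite gee0_abs ?lee_fin ?powR_ge0//.
Qed.

Lemma lp_seminorm_powR r u : 0 < r -> in_Lp r u ->
  lp_seminorm r u `^ r = \int[mu]_(x in Omega) (`|u x| `^ r).
Proof.
move=> r0 Lu; have rN0 : r != 0 by rewrite gt_eqF.
have /in_Lp_integrable[//|_ iu] := Lu.
apply: EFin_inj; rewrite /Rintegral fineK; last first.
  exact: integrable_fin_num.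
rewrite -poweR_EFin -lp_seminormE// Lp_norm_integral//.
by rewrite -poweRrM mulVf// poweRe1// integral_ge0.
Qed.

Lemma in_Lp_le r u v : 0 < r -> measurable_fun Omega v ->
  (forall x, Omega x -> `|v x| <= `|u x|) -> in_Lp r u ->
  in_Lp r v /\ lp_seminorm r v <= lp_seminorm r u.
Proof.
move=> r0 mv vu Lu; have rN0 : r != 0 by rewrite gt_eqF.
have /in_Lp_integrable[//|mu' iu] := Lu.
have le x : Omega x -> (`|v x| `^ r <= `|u x| `^ r).
  by move=> Ox; rewrite ge0_ler_powR ?nnegrE ?normr_ge0 ?(ltW r0)// vu.
have Lv : in_Lp r v.
  apply/in_Lp_integrable => //; split=> //.
  apply: le_integrable iu => //.
    by apply/measurable_EFinP; exact: measurable_norm_powR.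
  by move=> x Ox; rewrite !gee0_abs ?lee_fin ?powR_ge0// le.
split=> //; rewrite -lee_fin -!lp_seminormE// !Lp_norm_integral//.
have ge0 w : (0 <= \int[mu]_(x in Omega) (`|w x| `^ r)%:E)%E.
  by apply: integral_ge0 => x _; rewrite lee_fin powR_ge0.
rewrite gt0_ler_poweR ?invr_ge0 ?(ltW r0)//.
- by rewrite in_itv/= leey ge0.
- by rewrite in_itv/= leey ge0.
- apply: ge0_le_integral => //.
  + by apply/measurable_EFinP; exact: measurable_norm_powR.
  + by apply/measurable_EFinP; exact: measurable_norm_powR.
Qed.

Lemma in_LpZ r s u : 0 < r -> in_Lp r u -> in_Lp r (fun x => s * u x) /\
  lp_seminorm r (fun x => s * u x) = `|s| * lp_seminorm r u.
Proof.
move=> r0 Lu; have rN0 : r != 0 by rewrite gt_eqF.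
have /in_Lp_integrable[//|mu' iu] := Lu.
have E x : `|s * u x| `^ r = `|s| `^ r * `|u x| `^ r by rewrite normrM powRM.
have Lsu : in_Lp r (fun x => s * u x).
  apply/in_Lp_integrable => //; split; first exact: measurable_funM.
  by under eq_fun do rewrite E EFinM; exact: integrableZl.
split=> //; apply: EFin_inj; rewrite EFinM -!lp_seminormE// !Lp_norm_integral//.
under eq_integral do rewrite E EFinM.
rewrite integralZl// poweRM.
- by rewrite poweR_EFin -powRrM mulfV// powRr1.
- by rewrite lee_fin powR_ge0.
- by apply: integral_ge0 => x _; rewrite lee_fin powR_ge0.
Qed.

Lemma in_LpD r u v : 1 <= r -> in_Lp r u -> in_Lp r v ->
  in_Lp r (fun x => u x + v x) /\
  lp_seminorm r (fun x => u x + v x) <= lp_seminorm r u + lp_seminorm r v.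
Proof.
move=> r1 /[dup] Lu /in_LpP[mu' fu] /[dup] Lv /in_LpP[mv fv].
have le : (Lp_norm r (fun x => u x + v x)%R <= Lp_norm r u + Lp_norm r v)%E.
  rewrite /Defs.Lp_norm.
  have -> : (fun x => u x + v x) \_ Omega = ((u \_ Omega) \+ (v \_ Omega))%R.
    by apply/funext => x; rewrite /patch /=; case: ifPn => //; rewrite addr0.
  by apply: minkowski_EFin => //; apply/(measurable_restrictT _ mOmega).
have Luv : in_Lp r (fun x => u x + v x).
  apply/in_LpP; split; first exact: measurable_funD.
  by apply: le_lt_trans le _; rewrite lte_add_pinfty.
by split=> //; rewrite -lee_fin EFinD -!lp_seminormE.
Qed.

Lemma in_Lp_lin r s t u v : 1 <= r -> in_Lp r u -> in_Lp r v ->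
  in_Lp r (fun x => s * u x + t * v x) /\
  lp_seminorm r (fun x => s * u x + t * v x) <=
    `|s| * lp_seminorm r u + `|t| * lp_seminorm r v.
Proof.
move=> r1 Lu Lv; have r0 : 0 < r by exact: lt_le_trans r1.
have [Lsu <-] := in_LpZ s r0 Lu; have [Ltv <-] := in_LpZ t r0 Lv.
exact: in_LpD.
Qed.

Lemma in_Lp_norm r u : 0 < r -> in_Lp r u -> in_Lp r (fun x => `|u x|).
Proof.
move=> r0 Lu; apply: (in_Lp_le r0 _ _ Lu).1.
  exact: measurableT_comp (in_Lp_measurable Lu).
by move=> x _; rewrite normr_id.
Qed.

Lemma in_Lp_sum r (I : Type) (l : seq I) (f : I -> 'rV[R]_N -> R) : 1 <= r ->
  (forall i, in_Lp r (f i)) -> in_Lp r (fun x => \sum_(i <- l) f i x).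
Proof.
move=> r1 Lf; have r0 : 0 < r by exact: lt_le_trans r1.
elim: l => [|i l IH].
  apply/in_Lp_integrable => //; split.
    by under eq_fun do rewrite big_nil; exact: measurable_cst.
  under eq_fun do rewrite big_nil normr0 powR0 ?gt_eqF//.
  exact: integrable0.
under eq_fun do rewrite big_cons.
exact: (in_LpD r1 (Lf i) IH).1.
Qed.

Section finite.
Hypothesis finOmega : (mu Omega < +oo)%E.

Lemma integrable_bounded u K : measurable_fun Omega u ->
  (forall x, Omega x -> `|u x| <= K) -> mu.-integrable Omega (EFin \o u).
Proof.
move=> mu' uK; apply: measurable_bounded_integrable => //.
exists K; split; first exact: num_real.
by move=> K' KK' x Ox /=; rewrite (le_trans (uK _ Ox))// ltW.
Qed.

Lemma in_Lp_bounded r u K : 0 < r -> measurable_fun Omega u ->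
  (forall x, Omega x -> `|u x| <= K) -> in_Lp r u.
Proof.
move=> r0 mu' uK; apply/in_Lp_integrable => //; split=> //.
apply: (@integrable_bounded _ (K `^ r)); first exact: measurable_norm_powR.
move=> x Ox; rewrite ger0_norm ?powR_ge0// ge0_ler_powR ?nnegrE ?(ltW r0) ?uK//.
exact: le_trans (uK _ Ox).
Qed.

Lemma integrable_1powR q u : 0 < q -> in_Lp q u ->
  mu.-integrable Omega (fun x => (1 + `|u x| `^ q)%:E).
Proof.
move=> q0 /in_Lp_integrable[//|mu' iu].
under eq_fun do rewrite EFinD.
apply: integrableD => //.
apply: (@integrable_bounded (cst 1) 1); first exact: measurable_cst.
by move=> x _; rewrite normr1.
Qed.

Lemma in_Lp_incl q r u : 0 < q -> q <= r -> in_Lp r u -> in_Lp q u.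
Proof.
move=> q0 qr Lu; have r0 : 0 < r by exact: lt_le_trans qr.
have /in_Lp_integrable[//|mu' iu] := Lu.
apply/in_Lp_integrable => //; split=> //.
apply: le_integrable (integrable_1powR r0 Lu) => //.
  by apply/measurable_EFinP; exact: measurable_norm_powR.
move=> x Ox; rewrite !gee0_abs ?lee_fin ?addr_ge0 ?powR_ge0//.
by rewrite powR_le1D// ltW.
Qed.

Lemma in_Lp_integrable1 r u : 1 <= r -> in_Lp r u ->
  mu.-integrable Omega (EFin \o u).
Proof.
move=> r1 /(in_Lp_incl ltr01 r1) /in_Lp_integrable[//|mu' iu].
apply: le_integrable iu => //; first exact/measurable_EFinP.
by move=> x _; rewrite /= powRr1// normr_id.
Qed.

Lemma in_LpM r u (w : 'rV[R]_N -> R) K : 0 < r -> measurable_fun Omega w ->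
  (forall x, Omega x -> `|w x| <= K) ->
  in_Lp r u -> in_Lp r (fun x => w x * u x).
Proof.
move=> r0 mw wK Lu; apply: (in_Lp_le r0 _ _ (in_LpZ K r0 Lu).1).1.
  by apply: measurable_funM => //; exact: in_Lp_measurable Lu.
move=> x Ox; rewrite !normrM ler_wpM2r//.
by rewrite (le_trans (wK _ Ox))// ler_norm.
Qed.

(** The bound |w u|^q <= K^q (1 + |u|^r) integrates to a uniform bound on the
    unit ball of L^r, and homogeneity extends it to the whole space. *)
Lemma lp_seminorm_weight q r (w : 'rV[R]_N -> R) K :
  0 < q -> q <= r -> measurable_fun Omega w ->
  (forall x, Omega x -> `|w x| <= K) ->
  exists2 C, 0 < C & forall u, in_Lp r u ->
    lp_seminorm q (fun x => w x * u x) <= C * lp_seminorm r u.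
Proof.
move=> q0 qr mw wK; have r0 : 0 < r by exact: lt_le_trans qr.
pose m := fine (mu Omega); pose B := `|K| `^ q * (m + 1).
have m0 : 0 <= m by rewrite fine_ge0.
have B0 : 0 <= B by rewrite mulr_ge0 ?powR_ge0// addr_ge0.
have bound u : in_Lp r u -> lp_seminorm r u <= 1 ->
    lp_seminorm q (fun x => w x * u x) <= B `^ q^-1.
  move=> Lu u1; have Lq := in_Lp_incl q0 qr Lu.
  have Lw := in_LpM q0 mw wK Lq.
  have /in_Lp_integrable[//|mwu iwu] := Lw.
  have /in_Lp_integrable[//|mu' iu] := Lu.
  rewrite -[leLHS](@powRr1 _ (lp_seminorm _ _)) ?lp_seminorm_ge0//.
  rewrite -(@mulfV _ q) ?gt_eqF// powRrM.
  rewrite ge0_ler_powR ?nnegrE ?powR_ge0 ?invr_ge0 ?(ltW q0)//.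
  rewrite lp_seminorm_powR//.
  apply: (@le_trans _ _
      (\int[mu]_(x in Omega) (`|K| `^ q * (1 + `|u x| `^ r)))).
    apply: le_Rintegral => //.
      under [X in _.-integrable _ X]eq_fun do rewrite /= EFinM.
      by apply: integrableZl => //; exact: integrable_1powR.
    move=> x Ox; rewrite normrM powRM// ler_pM ?powR_ge0//; last first.
      by rewrite powR_le1D// ltW.
    by rewrite ge0_ler_powR ?nnegrE ?(ltW q0)// (le_trans (wK _ Ox))// ler_norm.
  rewrite RintegralZl//; last exact: integrable_1powR.
  rewrite ler_wpM2l ?powR_ge0// RintegralD//; last first.
    apply: (@integrable_bounded (cst 1) 1); first exact: measurable_cst.
    by move=> x _; rewrite normr1.
  rewrite Rintegral_cst// mul1r lerD2l -lp_seminorm_powR//.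
  by rewrite powR_le1 ?lp_seminorm_ge0// ltW.
exists (B `^ q^-1 + 1); first by rewrite ltr_wpDl ?powR_ge0.
move=> u Lu; apply/ler_addgt0Pl => e e0.
set C := B `^ q^-1 + 1; have C0 : 0 < C by rewrite ltr_wpDl ?powR_ge0.
(* Adding e / C makes k positive even if the seminorm of u vanishes, so that u
   / k is always in the unit ball. *)
pose k := lp_seminorm r u + e / C.
have k0 : 0 < k by rewrite ltr_wpDl ?lp_seminorm_ge0// divr_gt0.
have [Lku ku] := in_LpZ k^-1 r0 Lu.
have Lwu : in_Lp q (fun x => w x * u x).
  exact: in_LpM q0 mw wK (in_Lp_incl q0 qr Lu).
have := bound _ Lku; rewrite ku ger0_norm ?invr_ge0 ?(ltW k0)//.
have -> : (fun x => w x * (k^-1 * u x)) = (fun x => k^-1 * (w x * u x)).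
  by apply/funext => x; rewrite mulrCA.
rewrite (in_LpZ k^-1 q0 Lwu).2 ger0_norm ?invr_ge0 ?(ltW k0)//.
rewrite !ler_pdivrMl// mulr1 => h.
apply: (@le_trans _ _ (k * B `^ q^-1)).
  by apply: h; rewrite lerDl divr_ge0// ltW.
apply: (@le_trans _ _ (k * C)); first by rewrite ler_pM2l// lerDl.
by rewrite /k mulrDl divfK ?gt_eqF// mulrC addrC.
Qed.

End finite.

End lp_seminorm.

(** * Lebesgue measure and the topology of R^n *)

Section lebesgue_rV_theory.
Variables (R : realType) (n : nat).
Local Notation mu := (lebesgue_rV R n).

Lemma open_continuous_measurable_rV (U : set 'rV[R]_n) (f : 'rV[R]_n -> R) :
  open U -> {in U, continuous f} -> measurable_fun U f.
Proof.
move=> oU cf; apply: (measurability _ (RGenOpens.measurableE R)).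
move=> _ [_ [a [b ->] <-]]; apply: open_measurable_rV.
rewrite openE => x [Ux /= fx]; apply: filterI; first exact: open_nbhs_nbhs.
by apply: (cf x (mem_set Ux)); apply: open_nbhs_nbhs; split.
Qed.

Lemma continuous_measurable_rV (f : 'rV[R]_n -> R) :
  continuous f -> measurable_fun setT f.
Proof.
by move=> cf; apply: open_continuous_measurable_rV => //; exact: openT.
Qed.

Lemma coord_le_norm (v : 'rV[R]_n) i : `|v ord0 i| <= `|v|.
Proof.
have /mapP[j Hj ->] : `|v ord0 i| \in [seq `|v x.1 x.2| | x : 'I_1 * 'I_n].
  by apply/mapP; exists (ord0, i) => //=; rewrite mem_enum.
rewrite [leRHS]/Num.norm /= mx_normrE; apply/bigmax_geP; right => /=.
by exists j.
Qed.

Lemma lebesgue_rV_cube (c : 'rV[R]_n) (e : R) : 0 <= e ->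
  mu [set v | forall i, ball (c ord0 i) e (v ord0 i)] = ((e *+ 2) ^+ n)%:E.
Proof.
move=> e0.
rewrite (lebesgue_rV_box (A := fun i => ball (c ord0 i) e)); last first.
  by move=> i; exact: measurable_ball.
under eq_bigr do rewrite lebesgue_measure_ball//.
rewrite prodEFin; congr EFin.
by rewrite big_const_ord iter_mulr_1.
Qed.

Lemma lebesgue_rV_open_gt0 (U : set 'rV[R]_n) : open U -> U !=set0 ->
  (0 < mu U)%E.
Proof.
move=> oU [x Ux].
have /nbhs_ballP[e /= e0 eU] : nbhs x U by exact: open_nbhs_nbhs.
apply: (@lt_le_trans _ _ (mu [set v | forall i, ball (x ord0 i) e (v ord0 i)])).
  by rewrite lebesgue_rV_cube ?ltW// lte_fin exprn_gt0// mulrn_wgt0.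
apply: le_measure; rewrite ?inE.
- apply: (@measurable_box _ _ (fun i => ball (x ord0 i) e)) => i.
  exact: measurable_ball.
- exact: open_measurable_rV.
- move=> v xv; apply: eU; split=> // i j; rewrite (ord1 i); exact: xv.
Qed.

Lemma lebesgue_rV_bounded_fin (U : set 'rV[R]_n) :
  measurable U -> bounded_set U -> (mu U < +oo)%E.
Proof.
move=> mU [M [_ MU]]; pose K := `|M| + 1.
have K0 : 0 <= K + 1 by rewrite !addr_ge0.
have KU v : U v -> `|v| <= K.
  by apply: MU; rewrite (le_lt_trans (ler_norm M))// ltrDl.
pose B i := ball ((0 : 'rV[R]_n) ord0 i) (K + 1).
apply: (@le_lt_trans _ _ (mu [set v | forall i, B i (v ord0 i)])).
  apply: le_measure; rewrite ?inE//.
    by apply: (@measurable_box _ _ B) => i; exact: measurable_ball.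
  move=> v Uv i; rewrite /B /ball /= mxE sub0r normrN.
  apply: le_lt_trans (coord_le_norm _ _) _.
  by rewrite (le_lt_trans (KU _ Uv))// ltrDl.
by rewrite /B lebesgue_rV_cube// ltry.
Qed.

End lebesgue_rV_theory.

(** * Integrals of partial derivatives *)

(** Restricting f to a line or to a coordinate slice does not change its
    directional derivatives; c is the parametrization of the slice. *)
Lemma derive_affine (R : numFieldType) (V1 V2 W : normedModType R)
    (c : V1 -> V2) (f : V2 -> W) (a v : V1) (w : V2) :
  (forall h : R, c (h *: v + a) = h *: w + c a) ->
  (derivable (f \o c) a v <-> derivable f (c a) w) /\
  'D_v (f \o c) a = 'D_w f (c a).
Proof.
move=> cE; rewrite /derivable /derive /=.
have -> : (fun h : R => h^-1 *: (f (c (h *: v + a)) - f (c a))) =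
    (fun h : R => h^-1 *: (f (h *: w + c a) - f (c a))).
  by apply/funext => h; rewrite cE.
by [].
Qed.

Lemma partial_zero_near (R : realType) n (f : 'rV[R]_n -> R) i v :
  (\forall x \near v, f x = 0) -> partial i f v = 0.
Proof.
move=> fv; rewrite /partial (@near_eq_derive _ _ _ f (cst 0))//.
exact: derive_cst.
Qed.

Lemma integral_derive1_eq0 (R : realType) (F : R -> R) (B : R) :
  (forall x, derivable F x 1) -> continuous ('D_1 F) ->
  (forall x, B < `|x| -> F x = 0) ->
  (\int[lebesgue_measure]_x ('D_1 F x)%:E = 0)%E.
Proof.
move=> dF cF F0; pose K : R := `|B| + 1.
have BK : B < K by rewrite (le_lt_trans (ler_norm B))// ltrDl.
have K0 : 0 < K by rewrite ltr_wpDl.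
have D0 x : x \notin `[(- K), K] -> 'D_1 F x = 0.
  move=> xK; rewrite (@near_eq_derive _ _ _ F (cst 0)) ?derive_cst//.
  have Kx : B < `|x|.
    apply: (lt_trans BK); rewrite ltNge; apply: contra xK.
    by rewrite in_itv/= ler_norml.
  have nx : `|y| @[y --> x] --> `|x| by exact: norm_continuous.
  by near=> y; apply: F0; near: y; exact: cvgr_gt nx _ Kx.
have -> : (\int[lebesgue_measure]_x ('D_1 F x)%:E =
    \int[lebesgue_measure]_(x in `[(- K)%R, K]) ('D_1 F x)%:E)%E.
  rewrite [RHS]integral_mkcond; apply: eq_integral => x _.
  by rewrite /patch; case: ifPn => //; rewrite mem_setE => /D0 ->.
have KK : - K < K by rewrite (lt_trans _ K0)// oppr_lt0.
have contF : continuous F.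
  by move=> x; apply: differentiable_continuous; apply/derivable1_diffP.
rewrite (@continuous_FTC2 _ _ F)//.
- by rewrite !F0 ?subee// ?normrN (ger0_norm (ltW K0)).
- exact: continuous_subspaceT.
- split=> //.
  + by apply: cvg_at_right_filter; exact: contF.
  + by apply: cvg_at_left_filter; exact: contF.
- by move=> x _; rewrite derive1E.
Unshelve. all: by end_near. Qed.

Lemma rV_continuous (R : realType) (T : topologicalType) n (c : T -> 'rV[R]_n) :
  (forall i, continuous (fun x => c x ord0 i)) -> continuous c.
Proof.
move=> cc x; apply/cvgrPdist_lt => e e0; near=> y.
rewrite [ltLHS]/Num.norm /= mx_normrE.
apply/bigmax_ltP; split=> //= -[j i] _ /=.
rewrite (ord1 j) !mxE; move: i; near: y; apply: filter_forall => i.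
by apply: cvgr_dist_lt; [exact: (cc i x)|by []].
Unshelve. all: by end_near. Qed.

Lemma cons_rV_continuous_l (R : realType) n (v : 'rV[R]_n) :
  continuous (fun x : R => cons_rV (x, v)).
Proof.
apply: rV_continuous => i; case: (unliftP ord0 i) => [j|] -> x.
  under eq_fun do rewrite mxE liftK /=; exact: cvg_cst.
under eq_fun do rewrite mxE unlift_none /=; exact: cvg_id.
Qed.

Lemma cons_rV_continuous_r (R : realType) n (x : R) :
  continuous (fun v : 'rV[R]_n => cons_rV (x, v)).
Proof.
apply: rV_continuous => i; case: (unliftP ord0 i) => [j|] -> v.
  under eq_fun do rewrite mxE liftK /=; exact: coord_continuous.
under eq_fun do rewrite mxE unlift_none /=; exact: cst_continuous.
Qed.

Lemma integrable_continuous_bounded_support (R : realType) n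
    (g : 'rV[R]_n -> R) (B : R) :
  continuous g -> (forall (v : 'rV[R]_n) j, B < `|v ord0 j| -> g v = 0) ->
  (lebesgue_rV R n).-integrable setT (EFin \o g).
Proof.
move=> cg g0.
pose K := [set v : 'rV[R]_n |
  forall i, `[(- `|B|), `|B|]%classic (v ord0 i)].
have cK : compact K.
  apply: (@rV_compact _ _ (fun=> `[(- `|B|), `|B|]%classic)) => i.
  exact: segment_compact.
have mK : measurable K.
  by apply: (@measurable_box _ _ (fun=> `[(- `|B|), `|B|]%classic)) => i.
have finK : (lebesgue_rV R n K < +oo)%E.
  exact/lebesgue_rV_bounded_fin/compact_bounded.
have gK : EFin \o g = (EFin \o g) \_ K.
  apply/funext => v; rewrite /patch; case: ifPn => // /negP vK /=.
  congr EFin; have [j] : exists j, ~ `[(- `|B|), `|B|]%classic (v ord0 j).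
    apply: contrapT => /forallNP h; apply: vK; rewrite inE => i.
    exact: contrapT.
  move=> /negP; rewrite /= in_itv /= -ler_norml -ltNge => h.
  by apply: (g0 v j); rewrite (le_lt_trans (ler_norm B)).
rewrite gK; apply/(integrable_mkcond _ mK).
apply: measurable_bounded_integrable => //.
  exact: measurable_funTS (continuous_measurable_rV cg).
have /compact_bounded[M [Mr MB]] : compact (g @` K).
  by apply: continuous_compact => //; exact: continuous_subspaceT.
by exists M; split=> // M' MM' x Kx /=; apply: (MB _ MM'); exists x.
Qed.

(** By Fubini's theorem and induction on the dimension: if the first
    coordinate is the one differentiated, the inner integral over it is zero
    by the fundamental theorem of calculus; otherwise the inner integral is
    over the other coordinates, where the induction hypothesis applies to the
    slice. *)
Lemma integral_partial_eq0 (R : realType) n (f : 'rV[R]_n -> R) i (B : R) :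
  (forall v, derivable f v (delta_mx ord0 i)) -> continuous (partial i f) ->
  (forall (v : 'rV[R]_n) j, B < `|v ord0 j| -> f v = 0) ->
  (\int[lebesgue_rV R n]_v (partial i f v)%:E = 0)%E.
Proof.
elim: n f i => [|n IH] f i; first by case: i.
move=> df cf f0; set g := partial i f.
have g0 (v : 'rV[R]_n.+1) j : B < `|v ord0 j| -> g v = 0.
  move=> Bv; apply: partial_zero_near.
  have cj : `|w ord0 j| @[w --> v] --> `|v ord0 j|.
    by apply: cvg_norm; exact: coord_continuous.
  by near=> w; apply: (f0 w j); near: w; exact: cvgr_gt cj _ Bv.
have ig := integrable_continuous_bounded_support cf g0.
have mg : measurable_fun setT (EFin \o g).
  by apply/measurable_EFinP; exact: continuous_measurable_rV.
have mc := @measurable_cons_rV R n.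
pose T1 := measurableTypeR R.
pose nu := ((@lebesgue_measure R : {sigma_finite_measure set T1 -> \bar R})
  \x (lebesgue_rV R n))%E.
have inu : nu.-integrable setT ((EFin \o g) \o @cons_rV R n).
  apply/integrableP; split; first exact: measurableT_comp.
  move/integrableP : ig => [_].
  rewrite /= /lebesgue_step (ge0_integral_pushforward mc)//.
  apply/measurable_EFinP; apply: measurableT_comp => //.
  exact: continuous_measurable_rV.
transitivity (\int[nu]_z (g (cons_rV z))%:E)%E.
  exact: (integral_pushforward mc mg inu measurableT).
(* The map cons_rV is linear, so it parametrizes the slices by affine maps. *)
have consD (x y : R) (v w : 'rV[R]_n) :
    cons_rV (x + y, v + w) = cons_rV (x, v) + cons_rV (y, w).
  by apply/rowP => j; rewrite !mxE /=; case: unlift => // k; rewrite !mxE.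
have consZ (h x : R) (v : 'rV[R]_n) :
    cons_rV (h * x, h *: v) = h *: cons_rV (x, v).
  by apply/rowP => j; rewrite !mxE /=; case: unlift => // k; rewrite !mxE.
case: (unliftP ord0 i) => [j|] iE.
  have delta :
      cons_rV (0 : T1, delta_mx ord0 j) = delta_mx ord0 i :> 'rV[R]_n.+1.
    apply/rowP => k; rewrite iE !mxE /=.
    case: (unliftP ord0 k) => [l|] ->.
      by rewrite mxE /= (inj_eq lift_inj).
    by rewrite (negbTE (neq_lift _ _)).
  rewrite -(integral12_prod_meas1 inu); apply: integral0_eq => x _.
  have aff v (h : R) : cons_rV (x, h *: delta_mx ord0 j + v) =
      h *: delta_mx ord0 i + cons_rV (x, v).
    by rewrite -delta -consZ -consD mulr0 add0r.
  rewrite /fubini_F /=.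
  have pE v : g (cons_rV (x, v)) = partial j (fun v => f (cons_rV (x, v))) v.
    by rewrite /partial (derive_affine f (aff v)).2.
  under eq_integral do rewrite pE; apply: IH.
  - by move=> v; apply/(derive_affine f (aff v)).1.
  - have -> : partial j (fun v => f (cons_rV (x, v))) =
        g \o (fun v => cons_rV (x, v)).
      by apply/funext => v; rewrite -pE.
    move=> v; apply: continuous_comp; first exact: cons_rV_continuous_r.
    exact: cf.
  - by move=> v k Bv; apply: (f0 _ (lift ord0 k)); rewrite mxE liftK.
have delta : cons_rV (1 : T1, 0) = delta_mx ord0 i :> 'rV[R]_n.+1.
  apply/rowP => k; rewrite iE !mxE /=.
  case: (unliftP ord0 k) => [l|] ->; last by rewrite eqxx.
  by rewrite mxE eq_sym (negbTE (neq_lift _ _)).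
rewrite -(integral21_prod_meas1 inu); apply: integral0_eq => v _.
have aff x (h : R) : cons_rV (h *: 1 + x, v) =
    h *: delta_mx ord0 i + cons_rV (x, v).
  by rewrite -delta -consZ -consD scaler0 add0r.
rewrite /fubini_G /=.
have pE x : g (cons_rV (x, v)) = 'D_1 (fun x => f (cons_rV (x, v))) x.
  by rewrite (derive_affine f (aff x)).2.
under eq_integral do rewrite pE; apply: (@integral_derive1_eq0 _ _ B).
- by move=> x; apply/(derive_affine f (aff x)).1.
- have -> : 'D_1 (fun x => f (cons_rV (x, v))) = g \o (fun x => cons_rV (x, v)).
    by apply/funext => x; rewrite -pE.
  move=> x; apply: continuous_comp; first exact: cons_rV_continuous_l.
  exact: cf.
- by move=> x Bx; apply: (f0 _ ord0); rewrite mxE unlift_none.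
Unshelve. all: by end_near. Qed.

(** * Smooth functions of several variables *)

Section Ck_calculus.
Variables (R : realType) (n : nat).
Implicit Types (f g : 'rV[R]_n -> R).

Lemma Ck_continuous k f : Ck k f -> continuous f.
Proof. by case: k => [|k] []. Qed.

Lemma Ck_derivable k f : Ck k.+1 f ->
  forall i x, derivable f x (delta_mx ord0 i).
Proof. by move=> [_ Cf] i x; exact: (Cf i).1. Qed.
Arguments Ck_derivable {k f} _ i x.

Lemma Ck_partial k f i : Ck k.+1 f -> Ck k (partial i f).
Proof. by move=> [_ /(_ i)[]]. Qed.

Lemma CkS k f : Ck k.+1 f -> Ck k f.
Proof.
elim: k f => [|k IH] f Cf; first by split=> //; exact: Ck_continuous Cf.
split; first exact: Ck_continuous Cf.
move=> i; split; first by move=> x; exact: (Ck_derivable Cf).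
by apply: IH; exact: Ck_partial Cf.
Qed.

Lemma partial_lin s t f g i x :
  derivable f x (delta_mx ord0 i) -> derivable g x (delta_mx ord0 i) ->
  derivable (fun x => s * f x + t * g x) x (delta_mx ord0 i) /\
  partial i (fun x => s * f x + t * g x) x =
    s * partial i f x + t * partial i g x.
Proof.
move=> df dg.
by have [] := is_deriveD (is_deriveZ s (derivableP df))
  (is_deriveZ t (derivableP dg)).
Qed.

Lemma partialM f g i x :
  derivable f x (delta_mx ord0 i) -> derivable g x (delta_mx ord0 i) ->
  derivable (fun x => f x * g x) x (delta_mx ord0 i) /\
  partial i (fun x => f x * g x) x = f x * partial i g x + g x * partial i f x.
Proof.
by move=> df dg; have [] := is_deriveM (derivableP df) (derivableP dg).
Qed.

Lemma continuous_lin s t f g : continuous f -> continuous g ->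
  continuous (fun x => s * f x + t * g x).
Proof.
move=> cf cg x.
apply: (@continuousD _ _ _ (fun x => s * f x) (fun x => t * g x) x);
  apply: continuousM => //.
- exact: cst_continuous.
- exact: cf.
- exact: cst_continuous.
- exact: cg.
Qed.

Lemma continuous_mul f g : continuous f -> continuous g ->
  continuous (fun x => f x * g x).
Proof. by move=> cf cg x; apply: continuousM; [exact: cf|exact: cg]. Qed.

Lemma Ck_lin k s t f g : Ck k f -> Ck k g -> Ck k (fun x => s * f x + t * g x).
Proof.
elim: k f g => [|k IH] f g Cf Cg.
  split=> //; apply: continuous_lin; first exact: Ck_continuous Cf.
  exact: Ck_continuous Cg.
split.
  apply: continuous_lin; first exact: Ck_continuous Cf.
  exact: Ck_continuous Cg.
move=> i; split=> [x|].
  exact: (partial_lin s t (Ck_derivable Cf i x) (Ck_derivable Cg i x)).1.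
have -> : partial i (fun x => s * f x + t * g x) =
    (fun x => s * partial i f x + t * partial i g x).
  apply/funext => x.
  exact: (partial_lin s t (Ck_derivable Cf i x) (Ck_derivable Cg i x)).2.
by apply: IH; exact: Ck_partial.
Qed.

Lemma CkM k f g : Ck k f -> Ck k g -> Ck k (fun x => f x * g x).
Proof.
elim: k f g => [|k IH] f g Cf Cg.
  split=> //; apply: continuous_mul; first exact: Ck_continuous Cf.
  exact: Ck_continuous Cg.
split.
  apply: continuous_mul; first exact: Ck_continuous Cf.
  exact: Ck_continuous Cg.
move=> i; split=> [x|].
  exact: (@partialM f g i x (Ck_derivable Cf i x) (Ck_derivable Cg i x)).1.
have -> : partial i (fun x => f x * g x) =
    (fun x => 1 * (f x * partial i g x) + 1 * (g x * partial i f x)).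
  apply/funext => x; rewrite !mul1r.
  exact: (@partialM f g i x (Ck_derivable Cf i x) (Ck_derivable Cg i x)).2.
by apply: Ck_lin; apply: IH; by [exact: CkS|exact: Ck_partial].
Qed.

Lemma Ck_cst k (a : R) : Ck k (fun _ : 'rV[R]_n => a).
Proof.
elim: k a => [|k IH] a; split=> //; try exact: cst_continuous.
move=> i; split; first by move=> x; exact: derivable_cst.
have -> : partial i (fun _ : 'rV[R]_n => a) = (fun _ => 0).
  by apply/funext => x; exact: derive_cst.
exact: IH.
Qed.

Lemma Ck_prod k (I : Type) (l : seq I) (F : I -> 'rV[R]_n -> R) :
  (forall i, Ck k (F i)) -> Ck k (fun x => \prod_(i <- l) F i x).
Proof.
move=> CF; elim: l => [|i l IH].
  by under eq_fun do rewrite big_nil; exact: Ck_cst.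
by under eq_fun do rewrite big_cons; exact: CkM.
Qed.

(** A family of functions of one variable whose derivatives are linear
    combinations of members of the family consists of smooth functions; this
    covers sin and cos as well as the functions [flat m] below. *)
Lemma Ck_coord_family (I : Type) (F : I -> R -> R) (c1 c2 : I -> R)
    (n1 n2 : I -> I) :
  (forall a x, is_derive x (1 : R) (F a)
     (c1 a * F (n1 a) x + c2 a * F (n2 a) x)) ->
  forall k a (s d : R) i, Ck k (fun v : 'rV[R]_n => F a (s * v ord0 i + d)).
Proof.
move=> dF k a s d i.
have cF b : continuous (fun v : 'rV[R]_n => F b (s * v ord0 i + d)).
  move=> v.
  apply: (@continuous_comp _ _ _
    (fun v : 'rV[R]_n => s * v ord0 i + d) (F b)).
    apply: (@continuousD _ _ _ (fun v : 'rV[R]_n => s * v ord0 i) (fun=> d) v).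
      by apply: continuousM; [exact: cst_continuous|exact: coord_continuous].
    exact: cst_continuous.
  apply: differentiable_continuous; apply/derivable1_diffP.
  by have [] := dF b (s * v ord0 i + d).
elim: k a => [|k IH] a; first by [].
split=> // j.
pose c (v : 'rV[R]_n) : R := s * v ord0 i + d.
have aff v (h : R) : c (h *: delta_mx ord0 j + v) =
    h *: (s * (i == j)%:R : R) + c v.
  by rewrite /c !mxE /= mulrDr mulrCA addrA.
have dif x : differentiable (F a) x.
  by apply/derivable1_diffP; have [] := dF a x.
have aff' v := derive_affine (F a) (aff v).
split; first by move=> v; apply/(aff' v).1; exact: diff_derivable.
have -> : partial j (fun v : 'rV[R]_n => F a (s * v ord0 i + d)) =
  (fun v => (s * (i == j)%:R * c1 a) * F (n1 a) (s * v ord0 i + d) +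
            (s * (i == j)%:R * c2 a) * F (n2 a) (s * v ord0 i + d)).
  apply/funext => v; rewrite /partial (aff' v).2; set w := s * _.
  rewrite deriveE// -[w in 'd _ _ w]mulr1 linearZ -deriveE//.
  by rewrite (@derive_val _ _ _ _ _ _ _ (dF a _)) -!(mulrA w) -mulrDr.
exact: Ck_lin.
Qed.

End Ck_calculus.
Arguments Ck_derivable {R n k f} _ i x.

(** The classical flat function exp (- 1/x), multiplied by x^(- m): these
    factors appear when it is differentiated, and with them the family is
    closed under derivation. *)
Section flat.
Variable R : realType.

Definition flat (m : nat) (x : R) : R :=
  if 0 < x then x^-1 ^+ m * expR (- x^-1) else 0.

Lemma flat_gt0 m x : 0 < x -> 0 < flat m x.
Proof.
by move=> x0; rewrite /flat x0 mulr_gt0 ?expR_gt0// exprn_gt0// invr_gt0.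
Qed.

Lemma flat_le0 m x : x <= 0 -> flat m x = 0.
Proof. by move=> x0; rewrite /flat ltNge x0. Qed.

Lemma flat_ge0 m x : 0 <= flat m x.
Proof. by have [x0|x0] := ltP 0 x; [exact/ltW/flat_gt0|rewrite flat_le0]. Qed.

(** With y = 1/x the claim is y^(m+1) <= (m+1)^(m+1) exp y, which follows from
    exp (y / (m+1)) >= 1 + y / (m+1). *)
Lemma flat_le m x : 0 < x -> flat m x <= m.+1%:R ^+ m.+1 * x.
Proof.
move=> x0; rewrite /flat x0 expRN ler_pdivrMr ?expR_gt0//.
set y := x^-1; have y0 : 0 < y by rewrite invr_gt0.
have -> : y ^+ m = x * y ^+ m.+1 by rewrite exprS mulrA mulfV ?gt_eqF// mul1r.
rewrite mulrAC mulrC ler_pM2r//.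
have -> : expR y = expR (y / m.+1%:R) ^+ m.+1.
  by rewrite -expRM_natl mulrC divfK// pnatr_eq0.
rewrite -exprMn lerXn2r ?nnegrE ?(ltW y0) ?mulr_ge0 ?expR_ge0//.
rewrite mulrC -ler_pdivrMr//.
by rewrite (le_trans _ (expR_ge1Dx _))// lerDr.
Qed.

(** At 0 from the right, the difference quotient of [flat m] at h is [flat
    m.+1 h], and this tends to 0 by [flat_le]. *)
Lemma is_derive_flat m (x : R) : is_derive x (1 : R) (flat m)
  (- m%:R * flat m.+1 x + 1 * flat m.+2 x).
Proof.
have [x0|x0|<-] := ltgtP 0 x.
- apply: (@near_eq_is_derive R R R (fun x => x^-1 ^+ m * expR (- x^-1))).
    by near=> y; rewrite /flat ifT//; near: y; exact: lt_nbhsr.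
  have dV : is_derive x (1 : R) (fun y : R => y^-1) (- x ^- 2).
    apply: is_derive_eq.
      by apply: (@is_deriveV _ id); rewrite /= gt_eqF.
    by rewrite /GRing.scale /= mulr1.
  have dX := is_deriveX m dV.
  have dE := @is_derive1_comp _ expR (- (fun y : R => y^-1)) x _ _
    (is_derive_expR _) (is_deriveN dV).
  have -> : (fun x : R => x^-1 ^+ m * expR (- x^-1)) =
      (fun y : R => y^-1) ^+ m * (expR \o (- (fun y : R => y^-1))).
    by apply/funext => y; rewrite /GRing.mul /= exprfctE.
  apply: is_derive_eq (is_deriveM dX dE) _.
  rewrite /flat x0 /GRing.scale /= exprfctE opprK -!exprVn.
  by case: m {dX} => [|m] /=; rewrite ?exprS; ring.
- rewrite !flat_le0 ?(ltW x0)// !mulr0 addr0.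
  apply: (@near_eq_is_derive R R R (cst 0)).
  by near=> y; rewrite flat_le0//; near: y; exact: lt_le_nbhsl.
rewrite !flat_le0// !mulr0 addr0.
have lim : (fun h : R => h^-1 *: (flat m (h *: 1 + 0) - flat m 0)) @ 0^' -->
    (0 : R).
  apply/cvgrPdist_le => e e0; near=> h.
  rewrite sub0r normrN (flat_le0 m (lexx 0)) subr0 addr0 /GRing.scale /= mulr1.
  have [h0|h0] := leP h 0; first by rewrite flat_le0// mulr0 normr0 ltW.
  rewrite ger0_norm ?mulr_ge0 ?invr_ge0 ?flat_ge0 ?(ltW h0)//.
  have -> : h^-1 * flat m h = flat m.+1 h by rewrite /flat h0 exprS mulrA.
  rewrite (le_trans (flat_le _ h0))// mulrC -ler_pdivlMr ?exprn_gt0//.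
  near: h; apply: nbhs_dnbhs; apply: lt_le_nbhsl.
  by rewrite divr_gt0 ?exprn_gt0.
split; first by apply/cvg_ex; exists 0.
exact: cvg_lim lim.
Unshelve. all: by end_near. Qed.

End flat.

Section smooth_functions.
Variables (R : realType) (n : nat).
Implicit Types (f g phi : 'rV[R]_n -> R) (Omega U : set 'rV[R]_n).

Lemma Ck_flat k m (s d : R) i :
  Ck k (fun v : 'rV[R]_n => flat m (s * v ord0 i + d)).
Proof. by move: k m s d i; apply: Ck_coord_family; exact: is_derive_flat. Qed.

Let trig (b : bool) : R -> R := if b then sin else cos.

Let Ck_trig k b (s d : R) i :
  Ck k (fun v : 'rV[R]_n => trig b (s * v ord0 i + d)).
Proof.
move: k b s d i; apply: (@Ck_coord_family _ _ _ trig
  (fun b => if b then 1 else -1) (fun=> 0) negb negb).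
case=> x; rewrite /= mul0r addr0.
  by rewrite mul1r; exact: is_derive_sin.
by rewrite mulN1r; exact: is_derive_cos.
Qed.

Lemma Ck_sin k (s : R) i : Ck k (fun v : 'rV[R]_n => sin (s * v ord0 i)).
Proof. by have := Ck_trig k true s 0 i; under eq_fun do rewrite addr0. Qed.

Lemma Ck_cos k (s : R) i : Ck k (fun v : 'rV[R]_n => cos (s * v ord0 i)).
Proof. by have := Ck_trig k false s 0 i; under eq_fun do rewrite addr0. Qed.

Lemma partial_coord_comp (F : R -> R) (s : R) i (x : 'rV[R]_n) :
  derivable F (s * x ord0 i) 1 ->
  partial i (fun v => F (s * v ord0 i)) x = s * 'D_1 F (s * x ord0 i).
Proof.
move=> dF; pose c (v : 'rV[R]_n) : R := s * v ord0 i.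
have aff (h : R) : c (h *: delta_mx ord0 i + x) = h *: s + c x.
  by rewrite /c !mxE /= eqxx mulr1 mulrDr [s * h]mulrC.
rewrite /partial (derive_affine F aff).2 deriveE; last exact/derivable1_diffP.
by rewrite -[s in 'd _ _ s]mulr1 linearZ -deriveE//; exact/derivable1_diffP.
Qed.

Lemma test_function_support Omega f g : test_function Omega f ->
  (forall k, Ck k g) -> (forall x, f x = 0 -> g x = 0) -> test_function Omega g.
Proof.
move=> [_ cf sf] Cg fg.
have sub : closure [set x | g x != 0] `<=` closure [set x | f x != 0].
  apply: closure_subset => x /=; apply: contra => /eqP fx.
  by apply/eqP; exact: fg.
split=> //; last exact: subset_trans sub sf.
by apply: subclosed_compact cf sub; exact: closed_closure.
Qed.

Lemma test_function_lin Omega s t f g : test_function Omega f ->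
  test_function Omega g -> test_function Omega (fun x => s * f x + t * g x).
Proof.
move=> [Cf cf sf] [Cg cg sg].
have sub : closure [set x | s * f x + t * g x != 0] `<=`
    closure [set x | f x != 0] `|` closure [set x | g x != 0].
  rewrite -closureU; apply: closure_subset => x /=.
  have [-> |fx] := eqVneq (f x) 0; last by left.
  have [-> |gx] := eqVneq (g x) 0; last by right.
  by rewrite !mulr0 addr0 eqxx.
split; first by move=> k; exact: Ck_lin.
  apply: subclosed_compact (compactU cf cg) sub; exact: closed_closure.
by apply: subset_trans sub _ => x [/sf|/sg].
Qed.

(** The product over the coordinates of one-dimensional bumps, each made of
    two flat functions that vanish outside ]x0_i - r, x0_i + r[. *)
Lemma bump_function U (x0 : 'rV[R]_n) : open U -> U x0 ->
  exists phi, [/\ test_function U phi, forall x, 0 <= phi x & 0 < phi x0].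
Proof.
move=> oU Ux0.
have /nbhs_ballP[e /= e0 eU] : nbhs x0 U by exact: open_nbhs_nbhs.
pose r := e / 2; have r0 : 0 < r by rewrite divr_gt0.
pose phi (v : 'rV[R]_n) : R := \prod_i
  (flat 0 (1 * v ord0 i + (r - x0 ord0 i)) *
   flat 0 (-1 * v ord0 i + (r + x0 ord0 i))).
have C k : Ck k phi by apply: Ck_prod => i; apply: CkM; exact: Ck_flat.
pose K := [set v : 'rV[R]_n |
  forall i, `[(x0 ord0 i - r), (x0 ord0 i + r)]%classic (v ord0 i)].
have cK : compact K.
  apply: (@rV_compact _ _
    (fun i => `[(x0 ord0 i - r), (x0 ord0 i + r)]%classic)) => i.
  exact: segment_compact.
have clK : closed K by apply: compact_closed => //; exact: norm_hausdorff.
have KU : K `<=` U.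
  move=> v Kv; apply: eU; split=> // i j; rewrite (ord1 i).
  have := Kv j; rewrite /= in_itv /= -ler_distlC /ball /= => h.
  by apply: (le_lt_trans h); rewrite /r ltr_pdivrMr// ltr_pMr// ltr1n.
have sub : closure [set x | phi x != 0] `<=` K.
  rewrite ((closure_id K).1 clK); apply: closure_subset => v /= vphi i.
  rewrite /= in_itv /=; apply/negPn/negP; rewrite negb_and -!ltNge => h.
  move/negP: vphi; apply; rewrite /phi (bigD1 i)//= mulf_eq0 mulf_eq0.
  apply/orP; left; apply/orP; case/orP: h => h.
    by left; rewrite flat_le0//; lra.
  by right; rewrite flat_le0//; lra.
exists phi; split.
- split=> //; last exact: subset_trans sub KU.
  by apply: subclosed_compact cK sub; exact: closed_closure.
- by move=> x; apply: prodr_ge0 => i _; rewrite mulr_ge0 ?flat_ge0.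
- by apply: prodr_gt0 => i _; rewrite mulr_gt0// flat_gt0//; lra.
Qed.

End smooth_functions.

(** * Test functions as weakly differentiable functions *)

Section euclidean_norm.
Variables (R : realType) (n : nat).
Implicit Types (v w : 'rV[R]_n).

Lemma enorm_ge0 v : 0 <= enorm v. Proof. exact: sqrtr_ge0. Qed.

Let sumsq_ge0 v : 0 <= \sum_i v ord0 i ^+ 2.
Proof. by apply: sumr_ge0 => i _; exact: sqr_ge0. Qed.

Lemma sqr_enorm v : enorm v ^+ 2 = \sum_i v ord0 i ^+ 2.
Proof. by rewrite sqr_sqrtr. Qed.

Lemma enormZ (s : R) v : enorm (s *: v) = `|s| * enorm v.
Proof.
rewrite /enorm -sqrtr_sqr -sqrtrM ?sqr_ge0//; congr Num.sqrt.
by rewrite mulr_sumr; apply: eq_bigr => i _; rewrite mxE exprMn.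
Qed.

Lemma coord_le_enorm v i : `|v ord0 i| <= enorm v.
Proof.
rewrite -sqrtr_sqr ler_sqrt// (bigD1 i)//= lerDl.
by apply: sumr_ge0 => j _; exact: sqr_ge0.
Qed.

Lemma enorm_eq0 v : enorm v = 0 -> v = 0.
Proof.
move=> v0; apply/rowP => i; rewrite mxE; apply/eqP.
by rewrite -normr_eq0 eq_le normr_ge0 andbT -v0 coord_le_enorm.
Qed.

Lemma enorm0 : enorm (0 : 'rV[R]_n) = 0.
Proof.
rewrite /enorm big1 ?sqrtr0// => i _; by rewrite mxE expr0n.
Qed.

(** Cauchy-Schwarz: the terms are bounded by the arithmetic-geometric mean
    inequality with weights b / a and a / b, for which the sum is exactly a b.
    *)
Lemma dot_le_enorm v w : \sum_i v ord0 i * w ord0 i <= enorm v * enorm w.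
Proof.
have [v0|v0] := eqVneq (enorm v) 0.
  by rewrite v0 mul0r big1// => i _; rewrite (enorm_eq0 v0) mxE mul0r.
have [w0|w0] := eqVneq (enorm w) 0.
  by rewrite w0 mulr0 big1// => i _; rewrite (enorm_eq0 w0) mxE mulr0.
set a := enorm v; set b := enorm w.
have a0 : 0 < a by rewrite lt_def v0 enorm_ge0.
have b0 : 0 < b by rewrite lt_def w0 enorm_ge0.
have -> : a * b = \sum_i ((b / (2 * a)) * v ord0 i ^+ 2 +
    (a / (2 * b)) * w ord0 i ^+ 2).
  rewrite big_split /= -!mulr_sumr -!sqr_enorm -/a -/b.
  by field; rewrite !gt_eqF.
apply: ler_sum => i _; rewrite -subr_ge0.
have -> : b / (2 * a) * v ord0 i ^+ 2 + a / (2 * b) * w ord0 i ^+ 2 -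
    v ord0 i * w ord0 i = (b * v ord0 i - a * w ord0 i) ^+ 2 / (2 * a * b).
  by field; rewrite !gt_eqF.
by rewrite divr_ge0 ?sqr_ge0// !mulr_ge0// ltW.
Qed.

Lemma enormD v w : enorm (v + w) <= enorm v + enorm w.
Proof.
rewrite -(@ler_pXn2r _ 2) ?nnegrE ?addr_ge0 ?enorm_ge0//.
rewrite sqr_enorm sqrrD !sqr_enorm.
have -> : \sum_i (v + w) ord0 i ^+ 2 = \sum_i v ord0 i ^+ 2 +
    (\sum_i v ord0 i * w ord0 i) *+ 2 + \sum_i w ord0 i ^+ 2.
  by rewrite -sumrMnl -!big_split; apply: eq_bigr => i _; rewrite mxE sqrrD.
by rewrite lerD2r lerD2l lerMn2r dot_le_enorm orbT.
Qed.

Lemma enorm_le_sum v : enorm v <= \sum_i `|v ord0 i|.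
Proof.
have S0 : 0 <= \sum_i `|v ord0 i| by apply: sumr_ge0.
rewrite -(@ler_pXn2r _ 2) ?nnegrE ?enorm_ge0// sqr_enorm expr2 mulr_suml.
apply: ler_sum => i _.
rewrite -(real_normK (num_real (v ord0 i))) expr2 ler_wpM2l//.
by rewrite (bigD1 i)//= lerDl sumr_ge0.
Qed.

End euclidean_norm.

Section test_functions.
Variables (R : realType) (N : nat) (Omega : set 'rV[R]_N).
Hypotheses (oOmega : open Omega) (bOmega : bounded_set Omega).
Local Notation mu := (lebesgue_rV R N).
Implicit Types (f phi : 'rV[R]_N -> R).

Let mOmega : measurable Omega. Proof. exact: open_measurable_rV. Qed.
Let finOmega : (mu Omega < +oo)%E. Proof. exact: lebesgue_rV_bounded_fin. Qed.

Lemma test_function_out f x : test_function Omega f -> ~ Omega x -> f x = 0.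
Proof.
move=> [_ _ sf] nx; apply/eqP/negPn/negP => fx; apply: nx; apply: sf.
exact: subset_closure.
Qed.

Lemma test_function_partial f i : test_function Omega f ->
  test_function Omega (partial i f).
Proof.
move=> [Cf cf sf].
have sub : closure [set x | partial i f x != 0] `<=` closure [set x | f x != 0].
  rewrite [X in _ `<=` X](closure_id _).1; last exact: closed_closure.
  apply: closure_subset => x /= px; apply: contrapT => nx.
  move/eqP: px; apply; apply: partial_zero_near.
  have oC : open (~` closure [set x | f x != 0]).
    by apply: closed_openC; exact: closed_closure.
  have : nbhs x (~` closure [set x | f x != 0]) by exact: open_nbhs_nbhs.
  apply: filterS => y ny; apply/eqP/negPn/negP => fy; apply: ny.
  exact: subset_closure.
split; first by move=> k; exact: (@Ck_partial _ _ k f i (Cf k.+1)).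
  by apply: subclosed_compact cf sub; exact: closed_closure.
exact: subset_trans sub sf.
Qed.

Lemma test_function_continuous f : test_function Omega f -> continuous f.
Proof. by move=> [/(_ 0) [] ]. Qed.

Lemma test_function_bounded f : test_function Omega f ->
  exists K, forall x, `|f x| <= K.
Proof.
move=> tf; have [_ cf _] := tf.
have /compact_bounded[M [Mr MB]] : compact (f @` closure [set x | f x != 0]).
  apply: continuous_compact cf; apply: continuous_subspaceT.
  exact: test_function_continuous.
exists (Num.max 0 (M + 1)) => x; have [->|fx] := eqVneq (f x) 0.
  by rewrite normr0 le_max lexx.
rewrite le_max; apply/orP; right; apply: (MB (M + 1)); first by rewrite ltrDl.
by exists x => //; exact: subset_closure.
Qed.

Lemma test_function_measurable f : test_function Omega f ->
  measurable_fun Omega f.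
Proof.
move=> /test_function_continuous cf.
by apply: measurable_funTS; exact: continuous_measurable_rV.
Qed.

Lemma test_function_in_Lp r f : 0 < r -> test_function Omega f ->
  in_Lp Omega r f.
Proof.
move=> r0 tf; have [K fK] := test_function_bounded tf.
apply: (@in_Lp_bounded _ _ _ mOmega finOmega _ _ K) => //.
exact: test_function_measurable.
Qed.

Lemma test_functionM f phi : test_function Omega f -> (forall k, Ck k phi) ->
  test_function Omega (fun x => f x * phi x).
Proof.
move=> tf Cp; apply: (test_function_support tf).
  by have [Cf _ _] := tf => k; exact: CkM.
by move=> x ->; rewrite mul0r.
Qed.

Lemma test_function_integral_partial f i : test_function Omega f ->
  \int[mu]_(x in Omega) partial i f x = 0.
Proof.
move=> tf; have tp := test_function_partial i tf; have [Cf cf _] := tf.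
have [M [Mr MB]] := compact_bounded cf.
rewrite Rintegral_mkcond /Rintegral.
rewrite (eq_integral (fun x => (partial i f x)%:E)); last first.
  move=> x _; rewrite /patch; case: ifPn => // /negP nx.
  by rewrite (test_function_out tp)// => Ox; apply: nx; rewrite inE.
rewrite (@integral_partial_eq0 _ _ _ _ (M + 1))//.
- by move=> v; exact: (Ck_derivable (Cf 1%N)).
- exact: test_function_continuous tp.
move=> v j h; apply/eqP/negPn/negP => fv.
have cv : closure [set x | f x != 0] v by exact: subset_closure.
have := MB (M + 1); rewrite ltrDl ltr01 => /(_ isT v cv) /=.
by rewrite leNgt => /negP; apply; rewrite (lt_le_trans h)// coord_le_norm.
Qed.

(** For a test function phi, the product f phi is again a test function, so
    the integral of its partial derivative is zero. *)
Lemma test_function_weak_gradient f : test_function Omega f ->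
  weak_gradient Omega f (gradient f).
Proof.
move=> tf phi tphi i; have [Cf _ _] := tf; have [Cphi _ _] := tphi.
have := test_function_integral_partial i (test_functionM tf Cphi).
under eq_Rintegral => x _.
  rewrite (partialM (Ck_derivable (Cf 1%N) i x)
    (Ck_derivable (Cphi 1%N) i x)).2.
  over.
have int g h : test_function Omega g -> test_function Omega h ->
    mu.-integrable Omega (fun x => (g x * h x)%:E).
  move=> tg [Ch _ _].
  apply: (in_Lp_integrable1 mOmega finOmega (lexx 1)).
  by apply: test_function_in_Lp => //; exact: test_functionM.
rewrite RintegralD//; last 2 first.
- exact: int (test_function_partial _ _).
- exact: int (test_function_partial _ _).
move=> /eqP; rewrite addr_eq0 => /eqP ->; congr (- _).
by apply: eq_Rintegral => x _; rewrite mxE mulrC.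
Qed.

End test_functions.

(** * The linear structure of W_0^{1,p} *)

Section w01p_space.
Variables (R : realType) (N : nat) (Omega : set 'rV[R]_N) (p : R).
Hypotheses (oOmega : open Omega) (bOmega : bounded_set Omega) (p_ge1 : 1 <= p).
Local Notation mu := (lebesgue_rV R N).
Implicit Types (f phi : 'rV[R]_N -> R) (g h : 'rV[R]_N -> 'rV[R]_N).

Let mOmega : measurable Omega. Proof. exact: open_measurable_rV. Qed.
Let finOmega : (mu Omega < +oo)%E. Proof. exact: lebesgue_rV_bounded_fin. Qed.
Let p_gt0 : 0 < p. Proof. exact: lt_le_trans p_ge1. Qed.

Definition coord_in_Lp g := forall i, in_Lp Omega p (fun x => g x ord0 i).

Lemma coord_in_Lp_lin s t g h : coord_in_Lp g -> coord_in_Lp h ->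
  coord_in_Lp (fun x => s *: g x + t *: h x).
Proof.
move=> Lg Lh i; under eq_fun do rewrite !mxE.
exact: (in_Lp_lin mOmega s t p_ge1 (Lg i) (Lh i)).1.
Qed.

Lemma in_Lp_enorm g : coord_in_Lp g -> in_Lp Omega p (fun x => enorm (g x)).
Proof.
move=> Lg; have LS := in_Lp_sum mOmega (index_enum 'I_N) p_ge1
  (fun i => in_Lp_norm mOmega p_gt0 (Lg i)).
apply: (in_Lp_le mOmega p_gt0 _ _ LS).1; last first.
  move=> x _; rewrite ger0_norm ?enorm_ge0//.
  exact: le_trans (enorm_le_sum _) (ler_norm _).
apply: (@measurableT_comp _ _ _ _ _ _ (@Num.sqrt R)).
  by apply: continuous_measurable_fun; exact: sqrt_continuous.
apply: measurable_sum => i; apply: measurable_funX.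
exact: in_Lp_measurable (Lg i).
Qed.

Definition vec_seminorm g : R := lp_seminorm Omega p (fun x => enorm (g x)).

Lemma vec_seminorm_lin s t g h : coord_in_Lp g -> coord_in_Lp h ->
  vec_seminorm (fun x => s *: g x + t *: h x) <=
    `|s| * vec_seminorm g + `|t| * vec_seminorm h.
Proof.
move=> Lg Lh.
have [Ls le] := in_Lp_lin mOmega s t p_ge1 (in_Lp_enorm Lg) (in_Lp_enorm Lh).
have [La lea] := in_Lp_lin mOmega `|s| `|t| p_ge1
  (in_Lp_enorm Lg) (in_Lp_enorm Lh).
rewrite !normr_id in lea; apply: le_trans lea.
apply: (in_Lp_le mOmega p_gt0 _ _ La).2.
  exact: in_Lp_measurable (in_Lp_enorm (coord_in_Lp_lin s t Lg Lh)).
move=> x _; rewrite ger0_norm ?enorm_ge0//; apply: le_trans (ler_norm _).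
by rewrite (le_trans (enormD _ _))// !enormZ.
Qed.

Lemma vec_seminormZ s g : coord_in_Lp g ->
  vec_seminorm (fun x => s *: g x) = `|s| * vec_seminorm g.
Proof.
move=> Lg; have := (in_LpZ mOmega `|s| p_gt0 (in_Lp_enorm Lg)).2.
rewrite normr_id => <-; rewrite /vec_seminorm; congr lp_seminorm.
by apply/funext => x; rewrite enormZ.
Qed.

Lemma coord_le_vec_seminorm g i : coord_in_Lp g ->
  lp_seminorm Omega p (fun x => g x ord0 i) <= vec_seminorm g.
Proof.
move=> Lg; apply: (in_Lp_le mOmega p_gt0 _ _ (in_Lp_enorm Lg)).2.
  exact: in_Lp_measurable (Lg i).
by move=> x _; rewrite (ger0_norm (enorm_ge0 _)) coord_le_enorm.
Qed.

Lemma W01p_in_Lp (u : W01p Omega p) : in_Lp Omega p u.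
Proof. by have [] := W01p_sobolev u. Qed.

Lemma wgrad_in_Lp (u : W01p Omega p) : coord_in_Lp (wgrad u).
Proof. by have [] := W01p_sobolev u. Qed.

Lemma gradient_in_Lp f : test_function Omega f -> coord_in_Lp (gradient f).
Proof.
move=> tf i; under eq_fun do rewrite mxE.
by apply: test_function_in_Lp => //; exact: test_function_partial.
Qed.

Lemma test_function_W01p f : test_function Omega f ->
  exists u : W01p Omega p, (u = f :> ('rV[R]_N -> R)) /\ wgrad u = gradient f.
Proof.
move=> tf.
have S : sobolev Omega p f (gradient f).
  split; first exact: test_function_in_Lp.
    exact: gradient_in_Lp.
  exact: test_function_weak_gradient.
have L0 : Lp_norm Omega p (fun=> 0) = 0%E.
  rewrite /Lp_norm (_ : EFin \o _ = cst 0%E) ?Lnorm0 ?eqe ?gt_eqF//.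
  by apply/funext => x; rewrite /= /patch; case: ifP.
unshelve eexists (@MkW01p _ _ _ _ f (gradient f) S _); last by [].
exists (fun=> f); split=> //.
  under eq_fun do under eq_fun do rewrite subrr.
  by rewrite L0; exact: cvg_cst.
under eq_fun do under eq_fun do rewrite subrr enorm0.
by rewrite L0; exact: cvg_cst.
Qed.

Lemma Rintegral_lin s t (f1 f2 : 'rV[R]_N -> R) :
  mu.-integrable Omega (EFin \o f1) -> mu.-integrable Omega (EFin \o f2) ->
  \int[mu]_(x in Omega) (s * f1 x + t * f2 x) =
  s * \int[mu]_(x in Omega) f1 x + t * \int[mu]_(x in Omega) f2 x.
Proof.
move=> i1 i2; rewrite RintegralD//.
- by rewrite !RintegralZl.
- under [X in _.-integrable _ X]eq_fun do rewrite /= EFinM.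
  exact: integrableZl.
- under [X in _.-integrable _ X]eq_fun do rewrite /= EFinM.
  exact: integrableZl.
Qed.

Lemma weak_gradient_lin s t (u v : W01p Omega p) :
  weak_gradient Omega (fun x => s * u x + t * v x)
    (fun x => s *: wgrad u x + t *: wgrad v x).
Proof.
move=> phi tphi i; have tp := test_function_partial i tphi.
have int w f : in_Lp Omega p w -> test_function Omega f ->
    mu.-integrable Omega (EFin \o (fun x => w x * f x)).
  move=> Lw tf; have [K fK] := test_function_bounded tf.
  apply: (in_Lp_integrable1 mOmega finOmega p_ge1).
  under eq_fun do rewrite mulrC.
  apply: (@in_LpM _ _ _ mOmega _ _ _ K) => //.
  exact: test_function_measurable.
have [Lu Lgu /(_ _ tphi i) gu] := W01p_sobolev u.
have [Lv Lgv /(_ _ tphi i) gv] := W01p_sobolev v.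
under eq_Rintegral do rewrite mulrDl -!mulrA.
under [in RHS]eq_Rintegral do rewrite !mxE mulrDl -!mulrA.
rewrite (Rintegral_lin s t (int _ _ Lu tp) (int _ _ Lv tp)).
rewrite (Rintegral_lin s t (int _ _ (Lgu i) tphi) (int _ _ (Lgv i) tphi)).
by rewrite gu gv !mulrN opprD.
Qed.

(** For the convergence of linear combinations of approximating sequences. *)
Lemma cvg_lin_0 (s t : R) (a b c : nat -> \bar R) :
  (forall k, (0 <= c k)%E) ->
  (forall k, (c k <= `|s|%:E * a k + `|t|%:E * b k)%E) ->
  a @ \oo --> 0%E -> b @ \oo --> 0%E -> c @ \oo --> 0%E.
Proof.
move=> c0 cab a0 b0.
apply: (@squeeze_cvge _ _ _ _ (cst 0%E) _
  (fun k => `|s|%:E * a k + `|t|%:E * b k)%E).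
- by apply: nearW => k; rewrite c0 cab.
- exact: cvg_cst.
have -> : (0 = `|s|%:E * 0 + `|t|%:E * 0 :> \bar R)%E by rewrite !mule0 adde0.
apply: cvgeD; first by rewrite !mule0.
  exact: cvgeZl.
exact: cvgeZl.
Qed.

Lemma W01p_lin s t (u v : W01p Omega p) :
  exists w : W01p Omega p,
    (w = (fun x => s * u x + t * v x) :> ('rV[R]_N -> R)) /\
    wgrad w = (fun x => s *: wgrad u x + t *: wgrad v x).
Proof.
have S : sobolev Omega p (fun x => s * u x + t * v x)
    (fun x => s *: wgrad u x + t *: wgrad v x).
  split; last exact: weak_gradient_lin.
    exact: (in_Lp_lin mOmega s t p_ge1 (W01p_in_Lp u) (W01p_in_Lp v)).1.
  exact: coord_in_Lp_lin (wgrad_in_Lp u) (wgrad_in_Lp v).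
unshelve eexists (@MkW01p _ _ _ _ _ _ S _); last by [].
have [f [tf fu fgu]] := W01p_closure u.
have [h [th hv hgv]] := W01p_closure v.
have sub w f' : in_Lp Omega p w -> test_function Omega f' ->
    in_Lp Omega p (fun x => w x - f' x).
  move=> Lw tf'; have := (in_Lp_lin mOmega 1 (-1) p_ge1 Lw
    (test_function_in_Lp oOmega bOmega p_gt0 tf')).1.
  by under eq_fun do rewrite mul1r mulN1r.
have subg g f' : coord_in_Lp g -> test_function Omega f' ->
    coord_in_Lp (fun x => g x - gradient f' x).
  move=> Lw tf'; have := coord_in_Lp_lin 1 (-1) Lw (gradient_in_Lp tf').
  by under eq_fun do rewrite scale1r scaleN1r.
exists (fun k x => s * f k x + t * h k x); split.
- by move=> k; exact: test_function_lin.
- apply: (@cvg_lin_0 s t) fu hv => k; first exact: Lnorm_ge0.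
  have Lf := sub _ _ (W01p_in_Lp u) (tf k).
  have Lh := sub _ _ (W01p_in_Lp v) (th k).
  have [L le] := in_Lp_lin mOmega s t p_ge1 Lf Lh.
  have -> : (fun x => s * u x + t * v x - (s * f k x + t * h k x)) =
     (fun x => s * (u x - f k x) + t * (v x - h k x)).
    by apply/funext => x; ring.
  by rewrite !lp_seminormE// -!EFinM -EFinD lee_fin.
- apply: (@cvg_lin_0 s t) fgu hgv => k; first exact: Lnorm_ge0.
  have Lf := subg _ _ (wgrad_in_Lp u) (tf k).
  have Lh := subg _ _ (wgrad_in_Lp v) (th k).
  have le := vec_seminorm_lin s t Lf Lh.
  have -> : (fun x => enorm (s *: wgrad u x + t *: wgrad v x -
        gradient (fun x => s * f k x + t * h k x) x)) =
     (fun x => enorm (s *: (wgrad u x - gradient (f k) x) +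
       t *: (wgrad v x - gradient (h k) x))).
    apply/funext => x; congr enorm; apply/rowP => i; rewrite !mxE.
    have [Cf _ _] := tf k; have [Ch _ _] := th k.
    rewrite (@partial_lin _ _ s t (f k) (h k) i x (Ck_derivable (Cf 1%N) i x)
      (Ck_derivable (Ch 1%N) i x)).2.
    by ring.
  rewrite !lp_seminormE -?EFinM -?EFinD ?lee_fin//.
  + exact: in_Lp_enorm.
  + exact: in_Lp_enorm.
  + exact: in_Lp_enorm (coord_in_Lp_lin s t Lf Lh).
Qed.

End w01p_space.

(** * Positivity of integrals and oscillating test functions *)

Section bounded_domain.
Variables (R : realType) (N : nat) (Omega : set 'rV[R]_N).
Hypotheses (oOmega : open Omega) (bOmega : bounded_set Omega).
Local Notation mu := (lebesgue_rV R N).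

Let mOmega : measurable Omega. Proof. exact: open_measurable_rV. Qed.
Let finOmega : (mu Omega < +oo)%E. Proof. exact: lebesgue_rV_bounded_fin. Qed.

Lemma closure_bounded_compact : compact (closure Omega).
Proof.
have [M [_ MO]] := bOmega; pose K := `|M| + 1.
pose Q := [set v : 'rV[R]_N | forall i, `[(- K), K]%classic (v ord0 i)].
have cQ : compact Q.
  apply: (@rV_compact _ _ (fun=> `[(- K), K]%classic)) => i.
  exact: segment_compact.
apply: (subclosed_compact _ cQ); first exact: closed_closure.
have clQ : closed Q by apply: compact_closed => //; exact: norm_hausdorff.
rewrite ((closure_id Q).1 clQ); apply: closure_subset => v Ov i.
rewrite /= in_itv /= -ler_norml (le_trans (coord_le_norm _ _))//.
by apply: (MO K) => //; rewrite (le_lt_trans (ler_norm M))// ltrDl.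
Qed.

Lemma Rintegral_gt0 (g : 'rV[R]_N -> R) (c : R) (V : set 'rV[R]_N) :
  mu.-integrable Omega (EFin \o g) -> (forall x, Omega x -> 0 <= g x) ->
  open V -> V !=set0 -> V `<=` Omega -> 0 < c -> (forall x, V x -> c <= g x) ->
  0 < \int[mu]_(x in Omega) g x.
Proof.
move=> ig g0 oV V0 VO c0 cg; have mV := open_measurable_rV oV.
have muV := lebesgue_rV_open_gt0 oV V0.
rewrite /Rintegral fine_gt0//; apply/andP; split; last first.
  have := integrable_fin_num mOmega ig; rewrite fin_numE => /andP[_ h].
  by rewrite ltey.
apply: (@lt_le_trans _ _ (c%:E * mu V)%E); first by rewrite mule_gt0.
rewrite -(integral_cst mu mV c%:E).
apply: (@le_trans _ _ (\int[mu]_(x in V) (g x)%:E)%E).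
  apply: ge0_le_integral => //.
  - by move=> x _; rewrite lee_fin ltW.
  - apply: (measurable_funS mOmega VO).
    by move/integrableP : ig => [].
apply: ge0_subset_integral => //.
by move/integrableP : ig => [].
Qed.

(** Near x0 the function is at least half as large as at x0, and
    neighbourhoods have positive measure. *)
Lemma lp_seminorm_gt0 r f x0 : 0 < r -> test_function Omega f -> f x0 != 0 ->
  0 < lp_seminorm Omega r f.
Proof.
move=> r0 tf fx0; have Lf := test_function_in_Lp oOmega bOmega r0 tf.
have /in_Lp_integrable[//|//|mf iF] := Lf.
have Ox0 : Omega x0.
  by apply: contrapT => /(test_function_out tf) f0; rewrite f0 eqxx in fx0.
apply: (@gt0_powR _ _ r) => //; first exact: lp_seminorm_ge0.
rewrite lp_seminorm_powR//.
pose V := [set x | Omega x /\ `|f x0| / 2 < `|f x|]^°.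
apply: (@Rintegral_gt0 _ ((`|f x0| / 2) `^ r) V) => //.
- exact: open_interior.
- exists x0; rewrite /V /interior /=; apply: filterI.
    exact: open_nbhs_nbhs.
  have cf : `|f x| @[x --> x0] --> `|f x0|.
    have cf1 : continuous f by exact: (test_function_continuous tf).
    exact: (cvg_norm (cf1 x0)).
  by apply: (cvgr_gt _ cf); rewrite ltr_pdivrMr// ltr_pMr ?normr_gt0// ltr1n.
- by move=> x /interior_subset[].
- by rewrite powR_gt0// divr_gt0// normr_gt0.
- move=> x /interior_subset[_ /ltW h].
  by rewrite ge0_ler_powR ?nnegrE ?(ltW r0)// divr_ge0.
Qed.

(** Take phi sin (k x_i) and phi cos (k x_i) with a bump phi. Differentiating
    either one gives k times the other one, up to a term bounded independently
    of k; since the norms of the two add up to at least the norm of phi, both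
    gradients cannot be controlled by C when k is large. *)
Lemma oscillating_test_function p (i : 'I_N) C : 1 <= p -> Omega !=set0 ->
  exists2 f, test_function Omega f &
    C * lp_seminorm Omega p f < lp_seminorm Omega p (partial i f).
Proof.
move=> p1 [x0 Ox0]; have p0 : 0 < p by exact: lt_le_trans p1.
have [phi [tphi _ phi0]] := bump_function oOmega Ox0.
have nphi : 0 < lp_seminorm Omega p phi.
  by apply: (lp_seminorm_gt0 p0 tphi (x0 := x0)); rewrite gt_eqF.
set n0 := lp_seminorm Omega p phi in nphi.
set n1 := lp_seminorm Omega p (partial i phi).
(* The constant for which the estimates of kT and kS below add up to k n0 <=
   (k - 1) n0. *)
pose k := (2 * n1 + 2 * `|C| * n0) / n0 + 1.
have k0 : 0 < k.
  rewrite ltr_wpDl// divr_ge0 ?(ltW nphi)// addr_ge0// !mulr_ge0//.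
    exact: lp_seminorm_ge0.
  exact: ltW.
pose S (v : 'rV[R]_N) : R := sin (k * v ord0 i).
pose T (v : 'rV[R]_N) : R := cos (k * v ord0 i).
have tS : test_function Omega (fun x => phi x * S x).
  by apply: test_functionM => // m; exact: Ck_sin.
have tT : test_function Omega (fun x => phi x * T x).
  by apply: test_functionM => // m; exact: Ck_cos.
apply: contrapT => noex.
have hS : lp_seminorm Omega p (partial i (fun x => phi x * S x)) <=
    C * lp_seminorm Omega p (fun x => phi x * S x).
  by rewrite leNgt; apply/negP => h; apply: noex; exists (fun x => phi x * S x).
have hT : lp_seminorm Omega p (partial i (fun x => phi x * T x)) <=
    C * lp_seminorm Omega p (fun x => phi x * T x).
  by rewrite leNgt; apply/negP => h; apply: noex; exists (fun x => phi x * T x).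
have Lp f : test_function Omega f -> in_Lp Omega p f.
  exact: test_function_in_Lp.
have [Cphi _ _] := tphi.
have pS x : partial i (fun x => phi x * S x) x =
    k * (phi x * T x) + partial i phi x * S x.
  rewrite (partialM (Ck_derivable (Cphi 1%N) i x)
    (Ck_derivable (Ck_sin 1 k i) i x)).2.
  rewrite /S partial_coord_comp.
    by rewrite (@derive_val _ _ _ _ _ _ _ (is_derive_sin _)) /T; ring.
  by have [] := is_derive_sin (k * x ord0 i).
have pT x : partial i (fun x => phi x * T x) x =
    - k * (phi x * S x) + partial i phi x * T x.
  rewrite (partialM (Ck_derivable (Cphi 1%N) i x)
    (Ck_derivable (Ck_cos 1 k i) i x)).2.
  rewrite /T partial_coord_comp.
    by rewrite (@derive_val _ _ _ _ _ _ _ (is_derive_cos _)) /S; ring.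
  by have [] := is_derive_cos (k * x ord0 i).
have S1 x : `|S x| <= 1 by rewrite ler_norml sin_geN1 sin_le1.
have T1 x : `|T x| <= 1 by rewrite ler_norml cos_geN1 cos_le1.
have bd f (c : 'rV[R]_N -> R) : test_function Omega f ->
    test_function Omega (fun x => f x * c x) ->
    (forall x, `|c x| <= 1) ->
    lp_seminorm Omega p (fun x => f x * c x) <= lp_seminorm Omega p f.
  move=> tf tfc c1; apply: (in_Lp_le mOmega p0 _ _ (Lp _ tf)).2.
    exact: test_function_measurable tfc.
  by move=> x _; rewrite normrM ler_piMr.
have tp := test_function_partial i tphi.
have tpS : test_function Omega (fun x => partial i phi x * S x).
  by apply: test_functionM => // m; exact: Ck_sin.
have tpT : test_function Omega (fun x => partial i phi x * T x).
  by apply: test_functionM => // m; exact: Ck_cos.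
have CS f : test_function Omega (fun x => phi x * f x) ->
    (forall x, `|f x| <= 1) ->
    C * lp_seminorm Omega p (fun x => phi x * f x) <= `|C| * n0.
  move=> tf f1.
  apply: (@le_trans _ _ (`|C| * lp_seminorm Omega p (fun x => phi x * f x))).
    by rewrite ler_wpM2r ?lp_seminorm_ge0// ler_norm.
  by rewrite ler_wpM2l// bd.
have kT : k * lp_seminorm Omega p (fun x => phi x * T x) <= `|C| * n0 + n1.
  have [_ E] := in_LpZ mOmega k p0 (Lp _ tT).
  have [_] := in_Lp_lin mOmega 1 (-1) p1
    (Lp _ (test_function_partial i tS)) (Lp _ tpS).
  have -> : (fun x => 1 * partial i (fun x => phi x * S x) x +
      -1 * (partial i phi x * S x)) = (fun x => k * (phi x * T x)).
    by apply/funext => x; rewrite pS; ring.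
  rewrite E (ger0_norm (ltW k0)) normrN !normr1 !mul1r => /le_trans; apply.
  by rewrite lerD ?bd// (le_trans hS)// CS.
have kS : k * lp_seminorm Omega p (fun x => phi x * S x) <= `|C| * n0 + n1.
  have [_ E] := in_LpZ mOmega k p0 (Lp _ tS).
  have [_] := in_Lp_lin mOmega (-1) 1 p1
    (Lp _ (test_function_partial i tT)) (Lp _ tpT).
  have -> : (fun x => -1 * partial i (fun x => phi x * T x) x +
      1 * (partial i phi x * T x)) = (fun x => k * (phi x * S x)).
    by apply/funext => x; rewrite pT; ring.
  rewrite E (ger0_norm (ltW k0)) normrN !normr1 !mul1r => /le_trans; apply.
  by rewrite lerD ?bd// (le_trans hT)// CS.
have tSS : test_function Omega (fun x => phi x * S x * S x).
  by apply: test_functionM => // m; exact: Ck_sin.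
have tTT : test_function Omega (fun x => phi x * T x * T x).
  by apply: test_functionM => // m; exact: Ck_cos.
have n0ST : n0 <= lp_seminorm Omega p (fun x => phi x * S x) +
    lp_seminorm Omega p (fun x => phi x * T x).
  have [_] := in_LpD mOmega p1 (Lp _ tSS) (Lp _ tTT).
  have -> : (fun x => phi x * S x * S x + phi x * T x * T x) = phi.
    by apply/funext => x; rewrite -!mulrA -mulrDr -!expr2 addrC cos2Dsin2 mulr1.
  by move=> /le_trans; apply; rewrite lerD// bd.
have : k * n0 <= (k - 1) * n0.
  apply: (@le_trans _ _ ((`|C| * n0 + n1) + (`|C| * n0 + n1))).
    by apply: le_trans (lerD kS kT); rewrite -mulrDr ler_wpM2l// ltW.
  by rewrite /k addrK divfK ?gt_eqF//; lra.
by apply/negP; rewrite -ltNge ltr_pM2r// gtrBl.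
Qed.

End bounded_domain.

(** * The energy and the weighted integral *)

Lemma crosses_small_positive (R : realType) (f : R -> R) (e : R) :
  continuous f -> f 0 <= 0 -> 0 < f 1 -> 0 < e ->
  exists2 s, 0 <= s <= 1 & 0 < f s /\ f s <= e.
Proof.
move=> cf f0 f1 e0; pose v := Num.min e (f 1).
have v0 : 0 < v by rewrite lt_min e0 f1.
have [|s] := @IVT _ f 0 1 v ler01 (continuous_subspaceT cf).
  have v1 : v <= f 1 by rewrite ge_min lexx orbT.
  by rewrite ge_min (le_trans f0 (ltW v0)) le_max v1 orbT.
rewrite in_itv /= => s01 fs; exists s => //.
by rewrite fs ge_min lexx.
Qed.

Section functionals.
Variables (R : realType) (N : nat) (Omega : set 'rV[R]_N) (p q : R).
Variable a : 'rV[R]_N -> R.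
Hypotheses (oOmega : open Omega) (bOmega : bounded_set Omega).
Hypotheses (q_gt1 : 1 < q) (q_lt_p : q < p).
Hypothesis a_continuous : {within closure Omega, continuous a}.
Local Notation mu := (lebesgue_rV R N).
Local Notation W := (W01p Omega p).
Implicit Types (u v : W).

Let mOmega : measurable Omega. Proof. exact: open_measurable_rV. Qed.
Let finOmega : (mu Omega < +oo)%E. Proof. exact: lebesgue_rV_bounded_fin. Qed.
Let p_gt1 : 1 < p. Proof. exact: lt_trans q_lt_p. Qed.
Let p_ge1 : 1 <= p. Proof. exact: ltW. Qed.
Let q_gt0 : 0 < q. Proof. exact: lt_trans q_gt1. Qed.
Let p_gt0 : 0 < p. Proof. exact: lt_trans p_gt1. Qed.

Lemma coef_continuous : {in Omega, continuous a}.
Proof.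
rewrite -continuous_open_subspace//.
apply: continuous_subspaceW a_continuous; exact: subset_closure.
Qed.

Lemma coef_measurable : measurable_fun Omega a.
Proof. exact: open_continuous_measurable_rV coef_continuous. Qed.

Lemma coef_bounded : exists K, forall x, Omega x -> `|a x| <= K.
Proof.
have /compact_bounded[M [Mr MB]] : compact (a @` closure Omega).
  by apply: continuous_compact => //; exact: closure_bounded_compact.
exists (M + 1) => x Ox; apply: (MB (M + 1)); first by rewrite ltrDl.
by exists x => //; exact: subset_closure.
Qed.

Let NP u : R := lp_seminorm Omega p u.
Let NG u : R := vec_seminorm Omega p (wgrad u).
Let G u : R := \int[mu]_(x in Omega) (enorm (wgrad u x) `^ p).
Let P u : R := \int[mu]_(x in Omega) (`|u x| `^ p).
Let A u : R := weighted_int q a u.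

Lemma P_seminorm u : P u = NP u `^ p.
Proof. by rewrite /NP (lp_seminorm_powR mOmega p_gt0 (W01p_in_Lp u)). Qed.

Lemma G_seminorm u : G u = NG u `^ p.
Proof.
have Lg := in_Lp_enorm oOmega p_ge1 (@wgrad_in_Lp _ _ _ _ u).
rewrite /NG /vec_seminorm (lp_seminorm_powR mOmega p_gt0 Lg).
by apply: eq_Rintegral => x _; rewrite ger0_norm ?enorm_ge0.
Qed.

(** With the weights (a^+)^(1/q) and (a^-)^(1/q), the weighted integral
    becomes a difference of q-th powers of seminorms, to which Minkowski's
    inequality applies. *)
Lemma weighted_int_split : exists w1 w2 : 'rV[R]_N -> R,
  [/\ measurable_fun Omega w1, measurable_fun Omega w2,
      exists K, forall x, Omega x -> `|w1 x| <= K,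
      exists K, forall x, Omega x -> `|w2 x| <= K &
      forall u, A u = lp_seminorm Omega q (fun x => w1 x * u x) `^ q -
                      lp_seminorm Omega q (fun x => w2 x * u x) `^ q].
Proof.
have [K aK] := coef_bounded; have ma := coef_measurable.
pose w (b : R) x := (Num.max (b * a x) 0) `^ q^-1.
have mw b : measurable_fun Omega (w b).
  apply: (measurableT_comp (measurable_powR _)); apply: measurable_maxr => //.
  exact: measurable_funM.
have w0 b x : 0 <= Num.max (b * a x) 0 by rewrite le_max lexx orbT.
have wK b x : `|b| = 1 -> Omega x -> `|w b x| <= K `^ q^-1.
  move=> b1 Ox; rewrite ger0_norm ?powR_ge0//.
  have K0 : 0 <= K by exact: le_trans (aK x Ox).
  rewrite ge0_ler_powR ?nnegrE ?invr_ge0 ?(ltW q_gt0)// ge_max K0 andbT.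
  by rewrite (le_trans (ler_norm _))// normrM b1 mul1r aK.
have b1 : `|1 : R| = 1 by exact: normr1.
have bN1 : `|-1 : R| = 1 by rewrite normrN normr1.
exists (w 1), (w (-1)); split=> //.
- by exists (K `^ q^-1) => x; exact: wK.
- by exists (K `^ q^-1) => x; exact: wK.
move=> u.
have Lq := in_Lp_incl mOmega finOmega q_gt0 (ltW q_lt_p) (W01p_in_Lp u).
have L b : `|b| = 1 -> in_Lp Omega q (fun x => w b x * u x).
  by move=> hb; apply: (in_LpM mOmega q_gt0 (mw b) _ Lq) => x; exact: wK hb.
have wE b x : `|w b x * u x| `^ q = Num.max (b * a x) 0 * `|u x| `^ q.
  by rewrite normrM powRM// ger0_norm ?powR_ge0// powRVK.
have /in_Lp_integrable[//|//|_ i1] := L 1 b1.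
have /in_Lp_integrable[//|//|_ i2] := L (-1) bN1.
rewrite (lp_seminorm_powR mOmega q_gt0 (L 1 b1)).
rewrite (lp_seminorm_powR mOmega q_gt0 (L (-1) bN1)).
rewrite -(RintegralB mOmega i1 i2); apply: eq_Rintegral => x _.
rewrite !wE -mulrBl; congr (_ * _); rewrite mul1r mulN1r.
have [a0|a0] := leP 0 (a x).
  by rewrite max_r ?oppr_le0// subr0.
by rewrite max_l ?oppr_ge0 ?(ltW a0)// sub0r opprK.
Qed.

Lemma weighted_int_neq0 u : A u != 0 -> W01p_nonzero u.
Proof.
move=> Au u0; move/eqP: Au; apply.
rewrite /A /weighted_int /Rintegral.
rewrite (@ae_eq_integral _ _ _ mu Omega (cst 0%E))//.
- by rewrite integral0.
- apply/measurable_EFinP; apply: measurable_funM; first exact: coef_measurable.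
  apply: measurable_norm_powR => //; exact: in_Lp_measurable (W01p_in_Lp u).
- by apply: filterS u0 => x ux /ux /= ->; rewrite normr0 powR0 ?gt_eqF// mulr0.
Qed.

Lemma W01p_seminorm_lin s t u v (w : W) :
  (w = (fun x => s * u x + t * v x) :> ('rV[R]_N -> R)) ->
  NP w <= `|s| * NP u + `|t| * NP v.
Proof.
move=> wE; rewrite /NP wE.
exact: (in_Lp_lin mOmega s t p_ge1 (W01p_in_Lp u) (W01p_in_Lp v)).2.
Qed.

Lemma wgrad_seminorm_lin s t u v (w : W) :
  wgrad w = (fun x => s *: wgrad u x + t *: wgrad v x) ->
  NG w <= `|s| * NG u + `|t| * NG v.
Proof.
move=> wE; rewrite /NG wE.
by apply: vec_seminorm_lin => //; exact: wgrad_in_Lp.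
Qed.

Lemma W01p_scale u (t : R) : 0 < t -> exists v,
  [/\ G v = t `^ p * G u, P v = t `^ p * P u, A v = t `^ q * A u,
      NG v = t * NG u & NP v = t * NP u].
Proof.
move=> t0; have [v [vE gE]] := W01p_lin oOmega bOmega p_ge1 t 0 u u.
have vE' : v = (fun x => t * u x) :> ('rV[R]_N -> R).
  by rewrite vE; apply/funext => x; rewrite mul0r addr0.
have gE' : wgrad v = (fun x => t *: wgrad u x).
  by rewrite gE; apply/funext => x; rewrite scale0r addr0.
have NGv : NG v = t * NG u.
  by rewrite /NG gE' vec_seminormZ ?gtr0_norm//; exact: wgrad_in_Lp.
have NPv : NP v = t * NP u.
  by rewrite /NP vE' (in_LpZ mOmega t p_gt0 (W01p_in_Lp u)).2 gtr0_norm.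
have NG0 : 0 <= NG u by exact: lp_seminorm_ge0.
have NP0 : 0 <= NP u by exact: lp_seminorm_ge0.
exists v; split=> //.
- by rewrite !G_seminorm NGv powRM// ltW.
- by rewrite !P_seminorm NPv powRM// ltW.
- have [w1 [w2 [mw1 mw2 [K1 wK1] [K2 wK2] AE]]] := weighted_int_split.
  have Lq := in_Lp_incl mOmega finOmega q_gt0 (ltW q_lt_p) (W01p_in_Lp u).
  have E (w : 'rV[R]_N -> R) K : measurable_fun Omega w ->
      (forall x, Omega x -> `|w x| <= K) ->
      lp_seminorm Omega q (fun x => w x * v x) =
      t * lp_seminorm Omega q (fun x => w x * u x).
    move=> mw wK; have Lw := in_LpM mOmega q_gt0 mw wK Lq.
    rewrite -[X in X * _]gtr0_norm// -(in_LpZ mOmega t q_gt0 Lw).2.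
    congr lp_seminorm.
    by apply/funext => x; rewrite vE'; ring.
  rewrite !AE (E _ _ mw1 wK1) (E _ _ mw2 wK2).
  by rewrite !powRM ?lp_seminorm_ge0 ?(ltW t0)// mulrBr.
Qed.

(** Only the positive part of a contributes to an upper bound of A, and that
    part is the q-th power of a weighted L^q norm, bounded through the L^p
    norm of u. *)
Lemma weighted_int_powR_le : exists2 d, 0 < d &
  forall u, 0 < A u -> d * A u `^ (p / q) <= P u.
Proof.
have [w1 [w2 [mw1 mw2 [K1 wK1] [K2 wK2] AE]]] := weighted_int_split.
have [C C0 CP] := lp_seminorm_weight mOmega finOmega q_gt0 (ltW q_lt_p) mw1 wK1.
exists (C `^ p)^-1; first by rewrite invr_gt0 powR_gt0.
move=> u Au; rewrite ler_pdivrMl ?powR_gt0// P_seminorm.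
rewrite -powRM ?(ltW C0) ?lp_seminorm_ge0//.
apply: (@le_trans _ _
  (lp_seminorm Omega q (fun x => w1 x * u x) `^ p)); last first.
  rewrite ge0_ler_powR ?nnegrE ?(ltW p_gt0) ?lp_seminorm_ge0//.
    by rewrite mulr_ge0 ?(ltW C0) ?lp_seminorm_ge0.
  exact: CP (W01p_in_Lp u).
have -> : lp_seminorm Omega q (fun x => w1 x * u x) `^ p =
    (lp_seminorm Omega q (fun x => w1 x * u x) `^ q) `^ (p / q).
  by rewrite -powRrM mulrC divfK// gt_eqF.
rewrite ge0_ler_powR ?nnegrE ?(ltW Au) ?powR_ge0//.
  by rewrite divr_ge0 ?(ltW p_gt0) ?(ltW q_gt0).
by rewrite AE gerBl powR_ge0.
Qed.

Lemma lambda_star_le u : 0 < A u -> lambda_star Omega p q a * P u <= G u.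
Proof.
move=> Au; have Pu : 0 < P u.
  have [d d0 dP] := weighted_int_powR_le.
  by apply: lt_le_trans (dP u Au); rewrite mulr_gt0// powR_gt0.
rewrite -ler_pdivlMr//; apply: ge_inf.
  by exists 0 => _ [v _ <-]; rewrite divr_ge0 ?powR_ge0.
exists u.
  by split; [apply: weighted_int_neq0; rewrite gt_eqF|exact: ltW].
by rewrite G_seminorm P_seminorm.
Qed.

(** A bump supported in the open set where a is positive. *)
Lemma weighted_int_pos : (exists2 x, Omega x & 0 < a x) -> exists u, 0 < A u.
Proof.
move=> [x0 Ox0 ax0]; pose U := [set x | Omega x /\ 0 < a x].
have ca x : Omega x -> a y @[y --> nbhs x] --> a x.
  by move=> Ox; apply: coef_continuous; rewrite inE.
have oU : open U.
  rewrite openE => x [Ox ax]; apply: filterI; first exact: open_nbhs_nbhs.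
  exact: (cvgr_gt _ (ca x Ox)).
have [phi [tphi phi_ge0 phi0]] := bump_function oU (conj Ox0 ax0 : U x0).
have tphi' : test_function Omega phi.
  by have [C c s] := tphi; split=> //; apply: subset_trans s _ => x [].
have [u [uE _]] := test_function_W01p oOmega bOmega p_ge1 tphi'.
exists u; rewrite /A /weighted_int uE.
have [K aK] := coef_bounded.
pose V := [set x | [/\ Omega x, a x0 / 2 < a x & phi x0 / 2 < phi x]]^°.
have cphi : continuous phi by exact: (test_function_continuous tphi').
apply: (@Rintegral_gt0 _ _ _ oOmega _ ((a x0 / 2) * (phi x0 / 2) `^ q) V).
- have Lq := test_function_in_Lp oOmega bOmega q_gt0 tphi'.
  have /in_Lp_integrable[//|//|mphi iphi] := Lq.
  apply: (@le_integrable _ _ _ mu _ _ _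
    (fun x => K%:E * (`|phi x| `^ q)%:E)%E) => //.
  + apply/measurable_EFinP; apply: measurable_funM.
      exact: coef_measurable.
    exact: measurable_norm_powR.
  + move=> x Ox; rewrite -EFinM !abse_EFin lee_fin !normrM ler_wpM2r//.
    exact: le_trans (aK x Ox) (ler_norm _).
  + exact: integrableZl.
- move=> x Ox; have [Ux|nUx] := pselect (U x).
    by rewrite mulr_ge0 ?powR_ge0// ltW//; case: Ux.
  by rewrite (test_function_out tphi nUx) normr0 powR0 ?gt_eqF// mulr0.
- exact: open_interior.
- exists x0; rewrite /V /interior /=.
  have n1 : nbhs x0 Omega by exact: open_nbhs_nbhs.
  have n2 : nbhs x0 (fun x => a x0 / 2 < a x).
    by apply: (cvgr_gt _ (ca x0 Ox0)); rewrite ltr_pdivrMr// ltr_pMr// ltr1n.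
  have n3 : nbhs x0 (fun x => phi x0 / 2 < phi x).
    by apply: (cvgr_gt _ (cphi x0)); rewrite ltr_pdivrMr// ltr_pMr// ltr1n.
  by apply: filterS (filterI n1 (filterI n2 n3)) => x [? []].
- by move=> x /interior_subset[].
- by rewrite mulr_gt0 ?powR_gt0 ?divr_gt0.
- move=> x /interior_subset[Ox /ltW ax /ltW phx].
  rewrite ler_pM ?powR_ge0 ?divr_ge0 ?(ltW ax0)//.
  rewrite ge0_ler_powR ?nnegrE ?(ltW q_gt0) ?divr_ge0 ?(ltW phi0)//.
  by rewrite (le_trans phx)// ler_norm.
Qed.

(** An oscillating test function with a large enough ratio of the gradient
    norm to the norm, rescaled so that its gradient norm is K. *)
Lemma small_norm_large_gradient (i : 'I_N) : Omega !=set0 ->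
  forall d K, 0 < d -> 0 < K -> exists u, NP u <= d /\ NG u = K.
Proof.
move=> O0 d K d0 K0.
have [f tf fC] := oscillating_test_function oOmega bOmega i (K / d) p_ge1 O0.
have [u [uE gE]] := test_function_W01p oOmega bOmega p_ge1 tf.
have NPu : NP u = lp_seminorm Omega p f by rewrite /NP uE.
have fG : lp_seminorm Omega p (partial i f) <= NG u.
  have := coord_le_vec_seminorm oOmega p_ge1 i (@wgrad_in_Lp _ _ _ _ u).
  rewrite gE; under [X in lp_seminorm _ _ X <= _]eq_fun do rewrite mxE.
  by rewrite -gE.
have h : K / d * NP u < NG u by rewrite NPu (lt_le_trans fC).
have G0 : 0 < NG u.
  by apply: le_lt_trans h; rewrite mulr_ge0 ?lp_seminorm_ge0// divr_ge0// ltW.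
have [v [_ _ _ NGv NPv]] := W01p_scale u (divr_gt0 K0 G0).
exists v; split; last by rewrite NGv divfK// gt_eqF.
rewrite NPv mulrAC ler_pdivrMr// -ler_pdivrMl// mulrA [d^-1 * K]mulrC.
exact: ltW.
Qed.

(** Adding s v changes the two weighted seminorms of u by at most a constant
    times the L^p norm of v, and the difference of their q-th powers is
    continuous. *)
Lemma weighted_int_stable u : 0 < A u -> exists2 d, 0 < d &
  forall s v (w : W), 0 <= s <= 1 -> NP v <= d ->
    w = (fun x => 1 * u x + s * v x) :> ('rV[R]_N -> R) -> A u / 2 <= A w.
Proof.
have [w1 [w2 [mw1 mw2 [K1 wK1] [K2 wK2] AE]]] := weighted_int_split.
have [C1 C10 CP1] :=
  lp_seminorm_weight mOmega finOmega q_gt0 (ltW q_lt_p) mw1 wK1.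
have [C2 C20 CP2] :=
  lp_seminorm_weight mOmega finOmega q_gt0 (ltW q_lt_p) mw2 wK2.
move=> Au; set al := lp_seminorm Omega q (fun x => w1 x * u x).
set be := lp_seminorm Omega q (fun x => w2 x * u x).
have be0 : 0 <= be by exact: lp_seminorm_ge0.
have al0 : 0 < al.
  apply: (@gt0_powR _ _ q) => //; first exact: lp_seminorm_ge0.
  by apply: lt_le_trans Au _; rewrite AE gerBl powR_ge0.
have lim : `|al - t| `^ q - `|be + t| `^ q @[t --> (0 : R)] --> A u.
  have -> : A u = `|al - 0| `^ q - `|be + 0| `^ q.
    by rewrite subr0 addr0 AE !ger0_norm// ltW.
  apply: cvgB.
    apply: (@continuous_comp _ _ _ (fun t : R => al - t)
      (fun x : R => `|x| `^ q)).
      by apply: cvgB; [exact: cvg_cst|exact: cvg_id].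
    exact: continuous_norm_powR.
  apply: (@continuous_comp _ _ _ (fun t : R => be + t)
    (fun x : R => `|x| `^ q)).
    by apply: cvgD; [exact: cvg_cst|exact: cvg_id].
  exact: continuous_norm_powR.
have Au2 : A u / 2 < A u by rewrite ltr_pdivrMr// ltr_pMr// ltr1n.
have [eta [eta0 eta_al eta_A]] : exists eta : R, [/\ 0 < eta, eta < al &
    A u / 2 < `|al - eta| `^ q - `|be + eta| `^ q].
  near (0 : R)^'+ => t; exists t; split=> //.
  near: t; exact: (cvgr_gt _ (cvg_at_right_filter lim) _ Au2).
have C0 : 0 < C1 + C2 by exact: addr_gt0.
exists (eta / (C1 + C2)); first exact: divr_gt0.
move=> s v w /andP[s0 s1] vd wE.
have Lq (z : W) := in_Lp_incl mOmega finOmega q_gt0 (ltW q_lt_p) (W01p_in_Lp z).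
have v_eta C : 0 <= C -> C <= C1 + C2 -> C * NP v <= eta.
  move=> C_ge0 CC; apply: (@le_trans _ _ (C * (eta / (C1 + C2)))).
    by rewrite ler_wpM2l.
  by rewrite mulrA ler_pdivrMr// mulrC ler_pM2l.
have pert (k : 'rV[R]_N -> R) K C : measurable_fun Omega k ->
    (forall x, Omega x -> `|k x| <= K) ->
    (forall z, in_Lp Omega p z ->
      lp_seminorm Omega q (fun x => k x * z x) <= C * lp_seminorm Omega p z) ->
    0 <= C -> C <= C1 + C2 ->
    lp_seminorm Omega q (fun x => k x * w x) <=
      lp_seminorm Omega q (fun x => k x * u x) + eta /\
    lp_seminorm Omega q (fun x => k x * u x) - eta <=
      lp_seminorm Omega q (fun x => k x * w x).
  move=> mk kK kC C_ge0 CC.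
  have Lku := in_LpM mOmega q_gt0 mk kK (Lq u).
  have Lkv := in_LpM mOmega q_gt0 mk kK (Lq v).
  have Lkw := in_LpM mOmega q_gt0 mk kK (Lq w).
  have kv : s * lp_seminorm Omega q (fun x => k x * v x) <= eta.
    apply: (@le_trans _ _ (lp_seminorm Omega q (fun x => k x * v x))).
      by rewrite ler_piMl ?lp_seminorm_ge0.
    by apply: le_trans (kC _ (W01p_in_Lp v)) _; exact: v_eta.
  split.
    have := (in_Lp_lin mOmega 1 s (ltW q_gt1) Lku Lkv).2.
    have -> : (fun x => 1 * (k x * u x) + s * (k x * v x)) =
        (fun x => k x * w x).
      by apply/funext => x; rewrite wE; ring.
    rewrite normr1 mul1r ger0_norm// => /le_trans; apply.
    by rewrite lerD2l.
  have := (in_Lp_lin mOmega 1 (- s) (ltW q_gt1) Lkw Lkv).2.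
  have -> : (fun x => 1 * (k x * w x) + - s * (k x * v x)) =
      (fun x => k x * u x).
    by apply/funext => x; rewrite wE; ring.
  rewrite normr1 mul1r normrN ger0_norm// => h.
  by rewrite lerBlDr; apply: le_trans h _; rewrite lerD2l.
have C1D : C1 <= C1 + C2 by rewrite lerDl ltW.
have C2D : C2 <= C1 + C2 by rewrite lerDr ltW.
have [_ lo] := pert _ _ _ mw1 wK1 CP1 (ltW C10) C1D.
have [up _] := pert _ _ _ mw2 wK2 CP2 (ltW C20) C2D.
apply: (le_trans (ltW eta_A)); rewrite AE lerB//.
  rewrite ger0_norm ?subr_ge0 ?(ltW eta_al)//.
  rewrite ge0_ler_powR ?nnegrE ?(ltW q_gt0) ?subr_ge0 ?(ltW eta_al)//.
  exact: lp_seminorm_ge0.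
rewrite ger0_norm ?addr_ge0 ?(ltW eta0)//.
rewrite ge0_ler_powR ?nnegrE ?(ltW q_gt0) ?addr_ge0 ?(ltW eta0)//.
exact: lp_seminorm_ge0.
Unshelve. all: by end_near. Qed.

(** Along the segment from u to u + phi the energy goes continuously from a
    nonpositive value to a positive one when the gradient of phi is large,
    while A stays above A(u) / 2 when the L^p norm of phi is at most d. *)
Lemma small_energy (i : 'I_N) l u e : Omega !=set0 ->
  0 < A u -> G u - l * P u <= 0 -> 0 < e ->
  exists v, [/\ A u / 2 <= A v, 0 < G v - l * P v & G v - l * P v <= e].
Proof.
move=> O0 Au Eu e0; have [d d0 stable] := weighted_int_stable Au.
have NP0 (z : W) : 0 <= NP z by exact: lp_seminorm_ge0.
have NG0 (z : W) : 0 <= NG z by exact: lp_seminorm_ge0.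
(* A gradient norm of at least Y outweighs l P at u + phi, where the L^p norm
   is at most NP u + d. *)
pose Y := (`|l| + 1) * (NP u + d).
have NPd : 0 < NP u + d by rewrite ltr_wpDl.
have l1 : 0 < `|l| + 1 by rewrite ltr_wpDl.
have Y0 : 0 < Y by exact: mulr_gt0.
have [phi [phid phiG]] := small_norm_large_gradient i O0 d0
  (ltr_wpDl (NG0 u) Y0 : 0 < NG u + Y).
pose path (s : R) := W01p_lin oOmega bOmega p_ge1 1 s u phi.
pose w s := projT1 (cid (path s)).
have wE s : w s = (fun x => 1 * u x + s * phi x) :> ('rV[R]_N -> R).
  by rewrite /w; case: cid => z [].
have gE s : wgrad (w s) = (fun x => 1 *: wgrad u x + s *: wgrad phi x).
  by rewrite /w; case: cid => z [].
have lipP s t : NP (w t) <= NP (w s) + `|t - s| * NP phi.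
  rewrite -[X in X + _]mul1r -[X in X * NP (w s)]normr1.
  apply: W01p_seminorm_lin.
  by rewrite !wE; apply/funext => x; ring.
have lipG s t : NG (w t) <= NG (w s) + `|t - s| * NG phi.
  rewrite -[X in X + _]mul1r -[X in X * NG (w s)]normr1.
  apply: wgrad_seminorm_lin.
  rewrite !gE; apply/funext => x; rewrite !scale1r -addrA -scalerDl.
  by congr (_ + _ *: _); ring.
have lip_cont (F : R -> R) (K : R) : 0 <= K ->
    (forall s t, F t <= F s + `|t - s| * K) -> continuous F.
  move=> K_ge0 FK s; apply/cvgrPdist_le => eps eps0; near=> t.
  have st : `|s - t| * (K + 1) <= eps.
    rewrite -ler_pdivlMr ?ltr_wpDl//; near: t.
    apply: cvgr_dist_le; first exact: cvg_id.
    by rewrite divr_gt0// ltr_wpDl.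
  have stK : `|s - t| * K <= eps.
    by apply: le_trans st; rewrite ler_wpM2l// lerDl.
  rewrite ler_norml lerNl opprB lerBlDl lerBlDl; apply/andP; split.
    by rewrite (le_trans (FK s t))// lerD2l distrC.
  by rewrite (le_trans (FK t s))// lerD2l.
pose f s := G (w s) - l * P (w s).
have fE s : f s = `|NG (w s)| `^ p - l * `|NP (w s)| `^ p.
  by rewrite /f G_seminorm P_seminorm !ger0_norm.
have cf : continuous f.
  have -> : f = fun s => `|NG (w s)| `^ p - l * `|NP (w s)| `^ p.
    exact/funext.
  move=> s; apply: cvgB.
    apply: (@continuous_comp _ _ _ (fun s => NG (w s))
      (fun x : R => `|x| `^ p)).
      exact: lip_cont (NG0 phi) lipG s.
    exact: continuous_norm_powR.
  apply: cvgMl_tmp.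
  apply: (@continuous_comp _ _ _ (fun s => NP (w s)) (fun x : R => `|x| `^ p)).
    exact: lip_cont (NP0 phi) lipP s.
  exact: continuous_norm_powR.
have f0 : f 0 <= 0.
  have P0 : P (w 0) = P u.
    by apply: eq_Rintegral => x _; rewrite wE mul1r mul0r addr0.
  have G0 : G (w 0) = G u.
    by apply: eq_Rintegral => x _; rewrite gE scale1r scale0r addr0.
  by rewrite /f P0 G0.
have f1 : 0 < f 1.
  have NPw : NP (w 1) <= NP u + d.
    have := W01p_seminorm_lin (wE 1); rewrite !normr1 !mul1r.
    move=> /le_trans; apply.
    by rewrite lerD2l.
  have NGw : Y <= NG (w 1).
    have : NG phi <= `|1| * NG (w 1) + `|-1| * NG u.
      apply: wgrad_seminorm_lin; rewrite gE; apply/funext => x.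
      by rewrite !scale1r scaleN1r addrC addKr.
    by rewrite phiG normrN normr1 !mul1r addrC lerD2r.
  rewrite /f G_seminorm P_seminorm subr_gt0.
  apply: (@lt_le_trans _ _ (Y `^ p)); last first.
    by rewrite ge0_ler_powR ?nnegrE ?(ltW p_gt0) ?(ltW Y0).
  apply: (@le_lt_trans _ _ (`|l| * (NP u + d) `^ p)).
    apply: (@le_trans _ _ (`|l| * NP (w 1) `^ p)).
      by rewrite ler_wpM2r ?powR_ge0// ler_norm.
    by rewrite ler_wpM2l// ge0_ler_powR ?nnegrE ?(ltW p_gt0) ?(ltW NPd).
  rewrite /Y powRM ?(ltW l1) ?(ltW NPd)// ltr_pM2r ?powR_gt0//.
  apply: (@lt_le_trans _ _ (`|l| + 1)); first by rewrite ltrDl.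
  by rewrite le1r_powR// lerDr.
have [s s01 [fs0 fse]] := crosses_small_positive cf f0 f1 e0.
exists (w s); split; [|exact: fs0|exact: fse].
exact: stable s01 phid (wE s).
Unshelve. all: by end_near. Qed.

End functionals.

Theorem proposition1p6 (R : realType) (N : nat) (Omega : set 'rV[R]_N)
  (p q : R) (a : 'rV[R]_N -> R)
  (N_ge1 : (1 <= N)%N)
  (Omega_open : open Omega) (Omega_connected : connected Omega)
  (Omega_nonempty : Omega !=set0) (Omega_bounded : bounded_set Omega)
  (Omega_C2 : (2 <= N)%N -> C2_boundary Omega)
  (q_gt1 : 1 < q) (q_lt_p : q < p)
  (a_continuous : {within closure Omega, continuous a})
  (a_sign : sign_changing Omega a) :
  let M := ground_level Omega p q a in
  let lstar := lambda_star Omega p q a in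
  [/\ forall l, M l != +oo%E,
      (forall l m, l <= m -> (M m <= M l)%E) /\
      (forall l m, l < m -> m <= lstar -> (M m < M l)%E),
      forall l, l < lstar -> {for l, continuous M} &
      M l @[l --> lstar^'-] --> M lstar].
Proof.
move=> M lstar.
pose G (u : W01p Omega p) :=
  \int[lebesgue_rV R N]_(x in Omega) (enorm (wgrad u x) `^ p).
pose P (u : W01p Omega p) :=
  \int[lebesgue_rV R N]_(x in Omega) (`|u x| `^ p).
pose A (u : W01p Omega p) := weighted_int q a u.
have nz u : 0 < A u -> W01p_nonzero u.
  move=> Au; apply: (weighted_int_neq0 Omega_open q_gt1 a_continuous).
  by rewrite gt_eqF.
have scale u t : 0 < t ->
    exists v, [/\ G v = t `^ p * G u, P v = t `^ p * P u & A v = t `^ q * A u].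
  move=> t0; have [v [Gv Pv Av _ _]] :=
    W01p_scale Omega_open Omega_bounded q_gt1 q_lt_p a_continuous u t0.
  exists v; split; [exact: Gv|exact: Pv|exact: Av].
have Plow := weighted_int_powR_le Omega_open Omega_bounded
  q_gt1 q_lt_p a_continuous.
have Apos := weighted_int_pos Omega_open Omega_bounded
  q_gt1 q_lt_p a_continuous a_sign.1.
have small l u e := @small_energy _ _ _ _ _ _ Omega_open Omega_bounded
  q_gt1 q_lt_p a_continuous (Ordinal N_ge1) l u e Omega_nonempty.
have star u : 0 < A u -> lstar * P u <= G u.
  exact: lambda_star_le.
split.
- move=> l; rewrite -ltey; apply: lt_trans (ltry 0).
  exact: (level_lt0 q_gt1 q_lt_p nz scale Apos small l).
- split.
    exact: (level_nonincreasing q_gt1 q_lt_p nz scale Plow Apos small).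
  exact: (level_decreasing q_gt1 q_lt_p nz scale Plow Apos small star).
- exact: (level_continuous q_gt1 q_lt_p nz scale Plow Apos small star).
- exact: (level_left_continuous q_gt1 q_lt_p nz scale Plow Apos small star).
Qed.
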